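(* Let $A=kQ/I$ be a toupie algebra over a field $k$ of characteristic zero. If $a>0$, the classes of the elements $y_i$ (for the branches $\alpha^{(i)}$ containing monomial relations), $w_{pq}$ ($p\ne q$, $1\le p,q\le a$), $z_{us}$ ($1\le u\le a$, $\alpha^{(s)}\in{}_0\mathcal{B}_\omega\setminus Z$), $x_j$ ($2\le j\le a$) and $t_k$ ($1\le k\le r$) form a basis of $\mathrm{HH}^1(A)=\ker D_1/\operatorname{Im}D_0$. If $a=0$, let $\alpha^{(B)}$ be the last branch in the numbering; then the classes of all the elements $y_i$ and $t_k$ except the unique one among them having $\alpha^B_0\|\alpha^B_0$ as a summand form a basis of $\mathrm{HH}^1(A)$.
   Context: A finite quiver $Q$ is a toupie quiver if it has a unique source $0$, a unique sink $\omega$, and every other vertex is the source of exactly one arrow and the target of exactly one arrow. Paths are composed left to right. A branch is a path from $0$ to $\omega$; the arrows of a branch $\alpha^{(i)}$ are $\alpha^i_0,\alpha^i_1,\dots$ in order, $\alpha^i_0$ starting at $0$. A toupie algebra is $A=kQ/I$ with $Q$ toupie and $I$ an admissible ideal generated by monomial relations (paths inside one branch) and non-monomial relations (linear combinations of branches). Branches are numbered: $Z=\{\alpha^{(1)},\dots,\alpha^{(a)}\}$ the arrows from $0$ to $\omega$; then the $l$ branches of length $\ge2$ in no relation; then the $m$ branches containing monomial relations; then the $n$ branches involved in non-monomial relations. The non-monomial relations have coefficient matrix in reduced row echelon form, $\rho_i=\alpha^{(k_i)}+\sum_{j>k_i}b_{ij}\alpha^{(j)}$; $R$ is a minimal generating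 set of $I$ formed by these $\rho_i$ and monomial relations. $E=kQ_0$, $e_x$ trivial path at $x$, $D=\dim e_0Ae_\omega$, ${}_0\mathcal{B}_\omega$ the set of classes of branches containing no monomial relation and different from all $\alpha^{(k_i)}$. $Q_\rho$ is the graph whose vertices are branches of length $\ge2$ containing no monomial relation, with an edge between two of them if some $\rho_i$ involves both; $Q_\rho^1,\dots,Q_\rho^r$ are its connected components. For an arrow $\gamma$ and $h\in e_{s(\gamma)}Ae_{t(\gamma)}$, $\gamma\|h$ is the $E$-bimodule map $kQ_1\to A$ sending $\gamma$ to $h$, other arrows to $0$. $D_0:\mathrm{Hom}_{E^e}(E,A)\to\mathrm{Hom}_{E^e}(kQ_1,A)$, $D_0(e_x\|e_x)=\sum_{t(\gamma)=x}\gamma\|\gamma-\sum_{s(\gamma)=x}\gamma\|\gamma$; $D_1:\mathrm{Hom}_{E^e}(kQ_1,A)\to\mathrm{Hom}_{E^e}(kR,A)$, $D_1(f)(r)=\sum r^{(1)}f(r^{(2)})r^{(3)}$ (sum over factorizations of the paths of $r$ with $r^{(2)}$ an arrow, extended linearly). Elements: $y_i=\alpha^i_0\|\alpha^i_0$; $w_{pq}=\alpha^{(p)}\|\alpha^{(q)}$; $z_{us}=\alpha^{(u)}\|\alpha^{(s)}$; $x_j=\alpha^{(j)}\|\alpha^{(j)}-\alpha^{(1)}\|\alpha^{(1)}$; $t_k=\sum_{\alpha^{(i)}\in Q_\rho^k}\alpha^i_0\|\alpha^i_0$. *)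

(* Defs.v *)
From mathcomp Require Import all_boot all_order all_algebra.
Set Implicit Arguments. Unset Strict Implicit. Unset Printing Implicit Defensive.
Import GRing.Theory.
Local Open Scope ring_scope.

(* A (connected) toupie quiver is determined by its branches.  We fix n.+1    *)
(* branches, numbered 0 .. n (branch b here is the paper's alpha^(b+1)), and  *)
(* the length len b >= 1 of each.  Arrows are pairs (b, m) with m < len b,    *)
(* the arrow alpha^b_m.  Vertices: the source 0, the sink omega and, for each *)
(* arrow alpha^b_m with m > 0, its source (an interior vertex).               *)
(* Nontrivial paths are the contiguous segments alpha^b_i ... alpha^b_j of    *)
(* one branch (i <= j); trivial paths are e_x.                                *)

Section Toupie.
Variable k : fieldType.
Variable n : nat.
Variable len : 'I_n.+1 -> nat.

Definition Arr : finType := {b : 'I_n.+1 & 'I_(len b)}.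
Definition abr (g : Arr) : 'I_n.+1 := tag g.
Definition aidx (g : Arr) : nat := tagged g.

(* interior vertices: the source of an arrow alpha^b_m with 0 < m *)
Definition Mid : finType := {g : Arr | 0 < aidx g}%N.
Definition Vert : finType := option (option Mid).
Definition v0 : Vert := None.
Definition vomega : Vert := Some None.

(* the vertex sitting at position m (0 <= m <= len b) of branch b *)
Definition vpos (b : 'I_n.+1) (m : nat) : Vert :=
  if m == 0%N then v0 else
  if [pick v : Mid | (abr (val v) == b) && (aidx (val v) == m)] is Some v
  then Some (Some v) else vomega.

Definition asrc (g : Arr) : Vert := vpos (abr g) (aidx g).
Definition atgt (g : Arr) : Vert := vpos (abr g) (aidx g).+1.

(* nontrivial paths alpha^b_i ... alpha^b_j, given by first and last arrow *)
Definition Path : finType :=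
  {p : (Arr * Arr)%type | (abr p.1 == abr p.2) && (aidx p.1 <= aidx p.2)%N}.
Definition pfst (p : Path) : Arr := (val p).1.
Definition plst (p : Path) : Arr := (val p).2.
Definition psrc (p : Path) : Vert := asrc (pfst p).
Definition ptgt (p : Path) : Vert := atgt (plst p).
Definition plen (p : Path) : nat := (aidx (plst p) - aidx (pfst p)).+1.

Lemma arrpath_proof (g : Arr) : (abr (g, g).1 == abr (g, g).2) && (aidx (g, g).1 <= aidx (g, g).2)%N.
Proof. by rewrite /= eqxx leqnn. Qed.
Definition arrpath (g : Arr) : Path := exist _ (g, g) (arrpath_proof g).

(* all paths of Q: trivial (inl x = e_x) or nontrivial *)
Definition PathQ : finType := (Vert + Path)%type.
Definition qsrc (q : PathQ) : Vert := match q with inl x => x | inr p => psrc p end.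
Definition qtgt (q : PathQ) : Vert := match q with inl x => x | inr p => ptgt p end.
Definition qlen (q : PathQ) : nat := match q with inl _ => 0%N | inr p => plen p end.

Definition mulP (q1 q2 : PathQ) : option PathQ :=
  match q1, q2 with
  | inl x, inl y => if x == y then Some (inl x) else None
  | inl x, inr p => if x == psrc p then Some (inr p) else None
  | inr p, inl y => if ptgt p == y then Some (inr p) else None
  | inr p, inr q => if ptgt p == psrc q then
                      omap inr (insub (pfst p, plst q) : option Path)
                    else None
  end.

Definition kQ : vectType k := {ffun PathQ -> k^o}.
Definition pv (q : PathQ) : kQ := [ffun q' => (q' == q)%:R].
Definition optv (o : option PathQ) : kQ := if o is Some q then pv q else 0.
Definition kmul (u v : kQ) : kQ :=
  \sum_(q1 : PathQ) \sum_(q2 : PathQ) (u q1 * v q2) *: optv (mulP q1 q2).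

Definition ideal_gen (G : seq kQ) : {vspace kQ} :=
  <<flatten [seq [seq kmul (kmul (pv q1) g) (pv q2) | q1 <- enum PathQ, q2 <- enum PathQ]
              | g <- G]>>%VS.

(* x lies in R^m, R the arrow ideal: x is a combination of paths of length >= m *)
Definition in_Rpow (m : nat) (x : kQ) : Prop := forall q, x q != 0 -> (m <= qlen q)%N.

Definition admissible (I : {vspace kQ}) : Prop :=
  (forall x, x \in I -> in_Rpow 2 x) /\ (exists m, forall x, in_Rpow m x -> x \in I).

(* the branch alpha^(b), a path from 0 to omega, as an element of kQ *)
Definition brv (b : 'I_n.+1) : kQ :=
  \sum_(p : Path | (abr (pfst p) == b) && (psrc p == v0) && (ptgt p == vomega)) pv (inr p).

(* lifted Hom_{E^e}(kQ_1, -): functions on arrows *)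
Definition W : vectType k := {ffun Arr -> kQ}.
Definition bar (g : Arr) (h : kQ) : W := [ffun d => if d == g then h else 0].
Definition bar0 (b : 'I_n.+1) (h : kQ) : W :=
  [ffun g => if (abr g == b) && (aidx g == 0%N) then h else 0].

(* f is an E-bimodule map kQ_1 -> kQ: f(gamma) in e_{s gamma} kQ e_{t gamma} *)
Definition homE (f : W) : Prop :=
  forall (g : Arr) (q : PathQ), f g q != 0 -> (qsrc q == asrc g) && (qtgt q == atgt g).

(* D_0(e_x || e_x) *)
Definition D0 (x : Vert) : W :=
  \sum_(g : Arr | atgt g == x) bar g (pv (inr (arrpath g)))
  - \sum_(g : Arr | asrc g == x) bar g (pv (inr (arrpath g))).

Definition D1path (f : W) (q : PathQ) : kQ :=
  \sum_(t : PathQ * Arr * PathQ |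
        if mulP t.1.1 (inr (arrpath t.1.2)) is Some m then mulP m t.2 == Some q else false)
     kmul (kmul (pv t.1.1) (f t.1.2)) (pv t.2).
Definition D1 (f : W) (r : kQ) : kQ := \sum_(q : PathQ) r q *: D1path f q.

(* classes of the family X form a basis of the quotient K / Im,
   where K and Im are given by their lifts (membership predicates) *)
Definition quot_basis (inK inIm : W -> Prop) (X : seq W) : Prop :=
  (forall i : 'I_(size X), inK X`_i) /\
  (forall f, inK f -> exists c : 'I_(size X) -> k, inIm (f - \sum_(i < size X) c i *: X`_i)) /\
  (forall c : 'I_(size X) -> k, inIm (\sum_(i < size X) c i *: X`_i) -> forall i, c i = 0).

(* Data of the relations: nm monomial relations (paths) and nn non-monomial
   relations rho_i = sum_b (rho i b) alpha^(b), with pivots piv i = k_i. *)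
Variable nm nn : nat.
Variable mono : 'I_nm -> Path.
Variable rho : 'I_nn -> {ffun 'I_n.+1 -> k}.
Variable piv : 'I_nn -> 'I_n.+1.

Definition rhov (i : 'I_nn) : kQ := \sum_b rho i b *: brv b.

Definition RIdx : finType := ('I_nm + 'I_nn)%type.
Definition relR (j : RIdx) : kQ :=
  match j with inl i => pv (inr (mono i)) | inr i => rhov i end.
Definition Rseq : seq kQ := [seq relR j | j <- enum RIdx].
Definition Iid : {vspace kQ} := ideal_gen Rseq.

Definition minimal_gen : Prop :=
  forall j0, ideal_gen [seq relR j | j <- enum RIdx & j != j0] != Iid.

Definition rref : Prop :=
  [/\ forall i, rho i (piv i) = 1,
      forall i (b : 'I_n.+1), (b < piv i)%N -> rho i b = 0,
      forall i j : 'I_nn, (i < j)%N -> (piv i < piv j)%N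
    & forall i j : 'I_nn, i != j -> rho j (piv i) = 0].

Definition nonmono : Prop := forall i, (1 < #|[set b | rho i b != 0%R]|)%N.

Definition inZ (b : 'I_n.+1) : bool := len b == 1%N.
Definition hasMono (b : 'I_n.+1) : bool := [exists i, abr (pfst (mono i)) == b].
Definition inNM (b : 'I_n.+1) : bool := [exists i, rho i b != 0%R].
Definition isPivot (b : 'I_n.+1) : bool := [exists i, piv i == b].
Definition bclass (b : 'I_n.+1) : nat :=
  if inZ b then 0 else if hasMono b then 2 else if inNM b then 3 else 1.

Definition numbering : Prop :=
  (forall b, ~~ (hasMono b && inNM b)) /\
  (forall b b' : 'I_n.+1, (b <= b')%N -> (bclass b <= bclass b')%N).

(* a = number of arrows from 0 to omega *)
Definition aZ : nat := #|[set b | inZ b]|.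

Definition inVrho (b : 'I_n.+1) : bool := (1 < len b)%N && ~~ hasMono b.
Definition erho : rel 'I_n.+1 := fun b b' =>
  [&& inVrho b, inVrho b' & [exists i, (rho i b != 0%R) && (rho i b' != 0%R)]].
Definition comps : seq {set 'I_n.+1} :=
  undup [seq [set b' | connect erho b b'] | b <- enum 'I_n.+1 & inVrho b].

Definition yel (b : 'I_n.+1) : W :=
  [ffun g => if (abr g == b) && (aidx g == 0%N) then pv (inr (arrpath g)) else 0].
Definition wel (p q : 'I_n.+1) : W := bar0 p (brv q).   (* alpha^(p) || alpha^(q), p in Z *)
Definition zel (u s : 'I_n.+1) : W := bar0 u (brv s).   (* alpha^(u) || alpha^(s), u in Z *)
Definition xel (j : 'I_n.+1) : W := bar0 j (brv j) - bar0 ord0 (brv ord0).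
Definition tel (C : {set 'I_n.+1}) : W := \sum_(i in C) yel i.

Definition Bset (s : 'I_n.+1) : bool := ~~ inZ s && ~~ hasMono s && ~~ isPivot s.

Definition famA : seq W :=
  [seq yel i | i <- enum 'I_n.+1 & hasMono i]
  ++ [seq wel pq.1 pq.2 | pq <- [seq (p, q) | p <- enum 'I_n.+1, q <- enum 'I_n.+1]
                        & [&& inZ pq.1, inZ pq.2 & pq.1 != pq.2]]
  ++ [seq zel us.1 us.2 | us <- [seq (u, s) | u <- enum 'I_n.+1, s <- enum 'I_n.+1]
                        & inZ us.1 && Bset us.2]
  ++ [seq xel j | j <- enum 'I_n.+1 & inZ j && (j != ord0)]
  ++ [seq tel C | C <- comps].

(* a = 0: omit the element having alpha^B_0 || alpha^B_0 as a summand, B the last branch *)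
Definition fam0 : seq W :=
  [seq yel i | i <- enum 'I_n.+1 & hasMono i && (i != @ord_max n)]
  ++ map tel (filter (fun C : {set 'I_n.+1} => (@ord_max n) \notin C) comps).

(* lifts of ker D_1 and Im D_0 to Hom_{E^e}(kQ_1, kQ) *)
Definition homI (f : W) : Prop := homE f /\ forall g, f g \in Iid.
Definition inKer (f : W) : Prop := homE f /\ forall j, D1 f (relR j) \in Iid.
Definition inImg (f : W) : Prop :=
  exists c : Vert -> k, homI (f - \sum_(x : Vert) c x *: D0 x).

End Toupie.

(* Main.v *)
(* An arrow g of a branch of length > 1 is the only path parallel to itself, so a
   cochain f acts on it by a scalar; let C_b(f) be the sum of these scalars over the
   branch b.  An arrow u of Z is sent to an arbitrary element of e_0 A e_omega, which
   has the branches of Z and of 0_B_omega as basis because the rho_i are in reduced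
   echelon form.  Monomial relations impose no condition on f, and D_1 f (rho_i) =
   sum_b rho_ib C_b(f) alpha^(b) lies in I iff C_b(f) is constant on the support of
   rho_i; thus f is a cocycle iff C is constant on the components of Q_rho.  By
   telescoping along branches, f is a coboundary iff for some scalar lambda all
   C_b(f) equal lambda and f is lambda times the identity on the span of Z.  So HH^1
   is the space of pairs (C, matrix of f on Z) modulo the line spanned by
   (1, identity).  If a > 0, the given family spans the hyperplane where the Z-block
   has trace 0, and this is a complement of that line since the identity has trace
   a <> 0 in characteristic zero; if a = 0, the family spans the hyperplane
   where C vanishes on the last branch. *)
Require Import Defs.
From mathcomp Require Import all_boot all_order all_algebra.
Import GRing.Theory.
Local Open Scope ring_scope.

(** * Paths of a toupie quiver *)

Section ToupieQuiver.
Set Implicit Arguments. Unset Strict Implicit. Unset Printing Implicit Defensive.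
Variables (n : nat) (len : 'I_n.+1 -> nat).
Hypothesis len_gt0 : forall b, (0 < len b)%N.

Lemma aidx_lt (g : Arr len) : (aidx g < len (abr g))%N.
Proof. exact: ltn_ord. Qed.

Lemma arr_inj (g h : Arr len) : abr g = abr h -> aidx g = aidx h -> g = h.
Proof.
case: g h => [b i] [b' j]; rewrite /abr /aidx /= => e; subst b'.
by move=> /ord_inj ->.
Qed.

Lemma arr_exists b m : (m < len b)%N -> exists2 g : Arr len, abr g = b & aidx g = m.
Proof. by move=> lt_m; exists (existT (fun b => 'I_(len b)) b (Ordinal lt_m)). Qed.

Lemma path_inj (p q : Path len) : pfst p = pfst q -> plst p = plst q -> p = q.
Proof.
move=> e1 e2; apply: val_inj; rewrite [LHS]surjective_pairing [RHS]surjective_pairing.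
by congr pair.
Qed.

Lemma path_abr (p : Path len) : abr (plst p) = abr (pfst p).
Proof. by case/andP: (valP p) => /eqP. Qed.

Lemma path_aidx (p : Path len) : (aidx (pfst p) <= aidx (plst p))%N.
Proof. by case/andP: (valP p). Qed.

Lemma path_exists (g h : Arr len) :
  abr g = abr h -> (aidx g <= aidx h)%N -> exists p : Path len, pfst p = g /\ plst p = h.
Proof.
move=> /eqP e1 e2.
have H : (abr (g, h).1 == abr (g, h).2) && (aidx (g, h).1 <= aidx (g, h).2)%N by apply/andP.
by exists (exist _ (g, h) H).
Qed.

(** No arrow of the branch has index [len b], so the search in [vpos] fails and returns its default
    value, the sink; positive length rules out the source. *)
Lemma vpos_len b : vpos len b (len b) = vomega len.
Proof.
rewrite /vpos gtn_eqF //; case: pickP => // v /andP[/eqP e /eqP e'].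
by have := aidx_lt (val v); rewrite e e' ltnn.
Qed.

Lemma vpos_mid b m : (0 < m < len b)%N ->
  exists2 v : Mid len, vpos len b m = Some (Some v) & abr (val v) = b /\ aidx (val v) = m.
Proof.
case/andP=> m_gt0 lt_m; have [g gb gm] := arr_exists lt_m.
have Hg : (0 < aidx g)%N by rewrite gm.
rewrite /vpos gtn_eqF //; case: pickP => [v /andP[/eqP e /eqP e']|].
  by exists v.
by move/(_ (exist _ g Hg)); rewrite /= gb gm !eqxx.
Qed.

Variant vpos_spec b m : Vert len -> Prop :=
  | VposSource of m = 0%N : vpos_spec b m (v0 len)
  | VposSink of m = len b : vpos_spec b m (vomega len)
  | VposMid v of (0 < m < len b)%N & abr (val v) = b & aidx (val v) = m
      : vpos_spec b m (Some (Some v)).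

Lemma vposP b m : (m <= len b)%N -> vpos_spec b m (vpos len b m).
Proof.
rewrite leq_eqVlt => /orP[/eqP->|lt_m]; first by rewrite vpos_len; constructor.
case: (posnP m) => [->|m_gt0]; first by constructor.
have lm : (0 < m < len b)%N by rewrite m_gt0.
by have [v -> [? ?]] := vpos_mid lm; constructor.
Qed.

(** An interior vertex determines its branch and its position, so two branches meet only at the
    source and the sink. *)
Lemma vpos_eq b b' m m' : (m <= len b)%N -> (m' <= len b')%N ->
  vpos len b m = vpos len b' m' ->
  [\/ m = 0%N /\ m' = 0%N, m = len b /\ m' = len b' | b = b' /\ m = m'].
Proof.
move=> lm lm'; case: (vposP lm) => [->|->|v _ vb vm]; case: (vposP lm') => [->|->|v' _ vb' vm'] //.
- by constructor 1.
- by constructor 2.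
- by case=> e; subst v'; constructor 3; rewrite -vb -vm.
Qed.

Lemma vpos_eq0 b m : (m <= len b)%N -> (vpos len b m == v0 len) = (m == 0)%N.
Proof.
move=> lm; apply/eqP/eqP=> [|->//].
case: (vposP lm) => // -> e.
Qed.

Lemma vpos_eqomega b m : (m <= len b)%N -> (vpos len b m == vomega len) = (m == len b)%N.
Proof.
move=> lm; apply/eqP/eqP=> [|->]; last exact: vpos_len.
case: (vposP lm) => // -> e.
Qed.

Lemma atgt_neq0 (g : Arr len) : (atgt g == v0 len) = false.
Proof. by rewrite vpos_eq0 // aidx_lt. Qed.

Lemma asrc_neqomega (g : Arr len) : (asrc g == vomega len) = false.
Proof. by rewrite vpos_eqomega ?ltn_eqF ?aidx_lt // ltnW ?aidx_lt. Qed.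

Lemma asrc_eq0 (g : Arr len) : (asrc g == v0 len) = (aidx g == 0%N).
Proof. by rewrite vpos_eq0 // ltnW ?aidx_lt. Qed.

Lemma atgt_eqomega (g : Arr len) : (atgt g == vomega len) = ((aidx g).+1 == len (abr g)).
Proof. by rewrite vpos_eqomega ?aidx_lt. Qed.

(* Since no arrow ends at the source or starts at the sink, two consecutive
   arrows lie on the same branch. *)
Lemma atgt_asrc (g h : Arr len) : atgt g = asrc h -> abr g = abr h /\ (aidx g).+1 = aidx h.
Proof.
move=> e; case: (vpos_eq _ _ e) => [||[]//|[]//|//]; first exact: aidx_lt.
- exact/ltnW/aidx_lt.
- by move=> e1 e2; have := aidx_lt h; rewrite e2 ltnn.
Qed.

(** * Branches as paths, and paths parallel to an arrow *)

Definition firstarr b : Arr len := existT (fun b => 'I_(len b)) b (Ordinal (len_gt0 b)).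

Fact ltn_pred_len b : ((len b).-1 < len b)%N.
Proof. by rewrite prednK. Qed.

Definition lastarr b : Arr len := existT (fun b => 'I_(len b)) b (Ordinal (ltn_pred_len b)).

Fact brpath_proof b : (abr (firstarr b, lastarr b).1 == abr (firstarr b, lastarr b).2)
  && (aidx (firstarr b, lastarr b).1 <= aidx (firstarr b, lastarr b).2)%N.
Proof. by rewrite /= eqxx. Qed.

Definition brpath b : Path len := exist _ (firstarr b, lastarr b) (brpath_proof b).

Lemma abr_firstarr b : abr (firstarr b) = b. Proof. by []. Qed.

Lemma aidx_firstarr b : aidx (firstarr b) = 0%N. Proof. by []. Qed.

Lemma abr_lastarr b : abr (lastarr b) = b. Proof. by []. Qed.

Lemma aidx_lastarr b : aidx (lastarr b) = (len b).-1. Proof. by []. Qed.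

Lemma pfst_brpath b : pfst (brpath b) = firstarr b. Proof. by []. Qed.

Lemma plst_brpath b : plst (brpath b) = lastarr b. Proof. by []. Qed.

Lemma psrc_brpath b : psrc (brpath b) = v0 len. Proof. by []. Qed.

Lemma ptgt_brpath b : ptgt (brpath b) = vomega len.
Proof. by rewrite /ptgt /atgt plst_brpath abr_lastarr aidx_lastarr prednK // vpos_len. Qed.

Lemma brpath_inj : injective brpath.
Proof. by move=> b b' e; rewrite -(abr_firstarr b) -(abr_firstarr b') -!pfst_brpath e. Qed.

Lemma first_arr (g : Arr len) b : (abr g == b) && (aidx g == 0%N) = (g == firstarr b).
Proof.
apply/andP/eqP=> [[/eqP e1 /eqP e2]|->]; first exact: arr_inj.
by rewrite abr_firstarr aidx_firstarr.
Qed.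

Lemma path_source_sink (p : Path len) :
  psrc p = v0 len -> ptgt p = vomega len -> p = brpath (abr (pfst p)).
Proof.
move/eqP; rewrite asrc_eq0 => /eqP e1; move/eqP; rewrite atgt_eqomega => /eqP e2.
apply: path_inj; apply: arr_inj => //.
- by rewrite path_abr.
- by rewrite plst_brpath aidx_lastarr -path_abr -e2.
Qed.

(** When the branch has length greater than 1, one end of [g] is an interior vertex, which pins down
    branch and position. Arrows of [Z] are excluded: they are parallel to every branch. *)
Lemma path_parallel_arrow (g : Arr len) (p : Path len) : (1 < len (abr g))%N ->
  psrc p = asrc g -> ptgt p = atgt g -> p = arrpath g.
Proof.
have lp := aidx_lt (pfst p); have lq := aidx_lt (plst p); have lg := aidx_lt g.
have pb := path_abr p; have pi := path_aidx p.
move=> lt1 es et.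
have {es} := vpos_eq (ltnW lp) (ltnW lg) es.
have {et} := vpos_eq lq lg et.
move=> Ht Hs.
suff [e1 e2 e3] : [/\ abr (pfst p) = abr g, aidx (pfst p) = aidx g & aidx (plst p) = aidx g].
  by apply: path_inj; apply: arr_inj => //; rewrite pb.
case: Hs => [[s1 s2]|[s1 s2]|[s1 s2]]; last 1 first.
- split=> //; case: Ht => [[]//|[t1 t2]|[t1 [//]]].
  by apply: succn_inj; rewrite t1 t2 pb s1.
- case: Ht => [[]//|[t1 t2]|[t1 [t2]]]; last by split=> //; rewrite -?pb ?s1.
  by rewrite -t2 s2 in lt1.
- by rewrite s2 ltnn in lg.
Qed.

(** * Products and factorisations of paths *)

Lemma mulP_glue (p q s : Path len) :
  ptgt p = psrc q -> pfst s = pfst p -> plst s = plst q -> mulP (inr p) (inr q) = Some (inr s).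
Proof.
move=> e e1 e2; rewrite /mulP e eqxx.
case: insubP => [s' _ es'|].
  congr (Some (inr _)); apply: path_inj.
    by rewrite e1; exact: (congr1 fst es').
  by rewrite e2; exact: (congr1 snd es').
by rewrite /= -e1 -e2 path_abr eqxx path_aidx.
Qed.

Lemma asrc_neq_atgt (g : Arr len) : asrc g != atgt g.
Proof.
apply/eqP => e.
case: (vpos_eq (ltnW (aidx_lt g)) (aidx_lt g) e) => [[_]//|[e1 _]|[_]].
- by have := aidx_lt g; rewrite e1 ltnn.
- exact: n_Sn.
Qed.

(** Describes the equation [q p = s] at its left end only, so that the two ends of a factorisation
    [q1 p q2 = s] become independent conditions. *)
Definition left_cofactor (q : PathQ len) (p s : Path len) : Prop :=
  match q with
  | inl x => x = psrc p /\ pfst s = pfst p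
  | inr u => ptgt u = psrc p /\ pfst s = pfst u
  end.

Definition right_cofactor (q : PathQ len) (p s : Path len) : Prop :=
  match q with
  | inl x => x = ptgt p /\ plst s = plst p
  | inr u => ptgt p = psrc u /\ plst s = plst u
  end.

Lemma mulP_left q p r : mulP q (inr p) = Some r ->
  exists s : Path len, [/\ r = inr s, left_cofactor q p s & plst s = plst p].
Proof.
case: q => [x|u] /=.
  by case: eqP => // -> [<-]; exists p.
case: eqP => // e.
case: insubP => //= s _ es [<-].
by exists s; split=> //; [split=> //; exact: (congr1 fst es) | exact: (congr1 snd es)].
Qed.

Lemma mulP_right q p r : mulP (inr p) q = Some r ->
  exists s : Path len, [/\ r = inr s, right_cofactor q p s & pfst s = pfst p].
Proof.
case: q => [x|u] /=.
  by case: eqP => // -> [<-]; exists p.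
case: eqP => // e.
case: insubP => //= s _ es [<-].
by exists s; split=> //; [split=> //; exact: (congr1 snd es) | exact: (congr1 fst es)].
Qed.

Lemma mulP_leftE q p s : left_cofactor q p s -> plst s = plst p ->
  mulP q (inr p) = Some (inr s).
Proof.
case: q => [x [-> e1] e2|u [e0 e1] e2]; last exact: mulP_glue.
by rewrite /= eqxx; congr (Some (inr _)); apply: path_inj.
Qed.

Lemma mulP_rightE q p s : right_cofactor q p s -> pfst s = pfst p ->
  mulP (inr p) q = Some (inr s).
Proof.
case: q => [x [-> e1] e2|u [e0 e1] e2]; last exact: mulP_glue.
by rewrite /= eqxx; congr (Some (inr _)); apply: path_inj.
Qed.

(** A nontrivial cofactor ends just before [p], while a trivial one makes [s] and [p] start with the
    same arrow; these exclude each other. Among nontrivial cofactors both end arrows are forced. *)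
Lemma left_cofactor_inj q q' p s :
  left_cofactor q p s -> left_cofactor q' p s -> q = q'.
Proof.
have clash u : ptgt u = psrc p -> pfst s = pfst u -> pfst s = pfst p -> False.
  move=> /atgt_asrc [_ e] e1 e2; have := path_aidx u.
  by rewrite -e1 e2 -e ltnn.
case: q q' => [x|u] [x'|u'] /= [e1 e2] [e1' e2'].
- by rewrite e1 e1'.
- by case: (clash u').
- by case: (clash u).
- congr inr; apply: path_inj; first by rewrite -e2.
  case: (atgt_asrc e1) => b1 i1; case: (atgt_asrc e1') => b2 i2.
  by apply: arr_inj; [rewrite b1 | apply: succn_inj; rewrite i1].
Qed.

Lemma right_cofactor_inj q q' p s :
  right_cofactor q p s -> right_cofactor q' p s -> q = q'.
Proof.
have clash u : ptgt p = psrc u -> plst s = plst u -> plst s = plst p -> False.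
  move=> /atgt_asrc [_ e] e1 e2; have := path_aidx u.
  by rewrite -e1 e2 -e ltnn.
case: q q' => [x|u] [x'|u'] /= [e1 e2] [e1' e2'].
- by rewrite e1 e1'.
- by case: (clash u').
- by case: (clash u).
- congr inr; apply: path_inj; last by rewrite -e2.
  case: (atgt_asrc e1) => b1 i1; case: (atgt_asrc e1') => b2 i2.
  by apply: arr_inj; [rewrite -b1 | rewrite -i1].
Qed.

Lemma left_cofactor_exists (p s : Path len) : abr (pfst s) = abr (pfst p) ->
  (aidx (pfst s) <= aidx (pfst p))%N -> exists q, left_cofactor q p s.
Proof.
move=> eb; rewrite leq_eqVlt => /orP[/eqP ei|lt_i].
  by exists (inl (psrc p)); split=> //; apply: arr_inj.
have ltp : ((aidx (pfst p)).-1 < len (abr (pfst p)))%N.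
  exact: leq_ltn_trans (leq_pred _) (aidx_lt _).
have [g gb gi] := arr_exists ltp.
have [|u [u1 u2]] := @path_exists (pfst s) g (etrans eb (esym gb)).
  by rewrite gi -ltnS (ltn_predK lt_i).
exists (inr u); split=> //.
by rewrite /ptgt /psrc /atgt /asrc u2 gb gi (ltn_predK lt_i).
Qed.

Lemma right_cofactor_exists (p s : Path len) : abr (plst s) = abr (plst p) ->
  (aidx (plst p) <= aidx (plst s))%N -> exists q, right_cofactor q p s.
Proof.
move=> eb; rewrite leq_eqVlt => /orP[/eqP ei|lt_i].
  by exists (inl (ptgt p)); split=> //; apply: arr_inj.
have ltp : ((aidx (plst p)).+1 < len (abr (plst p)))%N.
  by rewrite -eb; apply: leq_ltn_trans lt_i (aidx_lt _).
have [g gb gi] := arr_exists ltp.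
have [|u [u1 u2]] := @path_exists g (plst s) (etrans gb (esym eb)).
  by rewrite gi.
exists (inr u); split=> //.
by rewrite /ptgt /psrc /atgt /asrc u1 gb gi.
Qed.

Lemma mulP3P q1 q2 p r s : mulP q1 (inr p) = Some r -> mulP r q2 = Some (inr s) ->
  left_cofactor q1 p s /\ right_cofactor q2 p s.
Proof.
move=> /mulP_left[u [-> l1 l2]] /mulP_right[v [[<-] r1 r2]]; split.
  by case: (q1) l1 => ? [e1 e2]; split; rewrite // r2.
have tu : ptgt u = ptgt p by rewrite /ptgt l2.
by case: (q2) r1 => ? [e1 e2]; split; rewrite -?tu // e2.
Qed.

(** Extend [p] first to the left, then to the right. With the uniqueness of cofactors, each subpath
    then occurs exactly once in [s]. *)
Lemma mulP3_exists (p s : Path len) : abr (pfst s) = abr (pfst p) ->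
  (aidx (pfst s) <= aidx (pfst p))%N -> (aidx (plst p) <= aidx (plst s))%N ->
  exists q1 q2 r, mulP q1 (inr p) = Some r /\ mulP r q2 = Some (inr s).
Proof.
move=> eb l1 l2.
have eb' : abr (pfst s) = abr (plst p) by rewrite path_abr.
have [|u [u1 u2]] := @path_exists (pfst s) (plst p) eb'.
  exact: leq_trans l1 (path_aidx p).
have [||q1 h1] := @left_cofactor_exists p u; rewrite ?u1 //.
have [||q2 h2] := @right_cofactor_exists u s; rewrite ?u2 ?path_abr -?eb //.
by exists q1, q2, (inr u); split; [apply: mulP_leftE | apply: mulP_rightE].
Qed.

End ToupieQuiver.

(** * The path algebra and the differentials *)

Section PathAlgebra.
Set Implicit Arguments. Unset Strict Implicit. Unset Printing Implicit Defensive.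
Variables (k : fieldType) (n : nat) (len : 'I_n.+1 -> nat).
Hypothesis len_gt0 : forall b, (0 < len b)%N.

Local Notation kQ := (kQ k len).
Local Notation W := (W k len).
Local Notation pv := (@pv k n len).
Local Notation pb b := (inr (brpath len_gt0 b) : PathQ len).
Local Notation pa g := (inr (arrpath g) : PathQ len).

(** * Coordinates and products in the path algebra *)

Lemma pvE (q q' : PathQ len) : pv q q' = (q' == q)%:R.
Proof. by rewrite ffunE. Qed.

Lemma sum_delta_scale (V : lmodType k) (T : finType) (G : T -> V) t0 :
  \sum_t (t == t0)%:R *: G t = G t0.
Proof.
rewrite (bigD1 t0) //= eqxx scale1r big1 ?addr0 // => t /negPf ->.
exact: scale0r.
Qed.

Lemma sum_mul_delta (T : finType) (c : T -> k) t0 : \sum_t c t * (t0 == t)%:R = c t0.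
Proof.
rewrite (bigD1 t0) //= eqxx mulr1 big1 ?addr0 // => t.
by rewrite eq_sym => /negPf ->; rewrite mulr0.
Qed.

Lemma kQ_scaleE c (u : kQ) q : (c *: u) q = c * u q.
Proof. by rewrite ffunE. Qed.

Lemma sum_mul_delta_cond (T : finType) (P : pred T) (c : T -> k) t0 :
  \sum_(t | P t) c t * (t0 == t)%:R = if P t0 then c t0 else 0.
Proof.
rewrite big_mkcond -[RHS](sum_mul_delta (fun t => if P t then c t else 0)).
by apply: eq_bigr => t _; case: ifP => // _; rewrite mul0r.
Qed.

Lemma kQ_subE (u v : kQ) q : (u - v) q = u q - v q.
Proof. by rewrite !ffunE. Qed.

Lemma kQ_sumE (T : finType) P (F : T -> kQ) q : (\sum_(t | P t) F t) q = \sum_(t | P t) F t q.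
Proof. by rewrite sum_ffunE. Qed.

Lemma W_scaleE c (f : W) g : (c *: f) g = c *: f g.
Proof. by rewrite ffunE. Qed.

Lemma W_subE (f f' : W) g : (f - f') g = f g - f' g.
Proof. by rewrite !ffunE. Qed.

Lemma W_sumE (T : finType) P (F : T -> W) g : (\sum_(t | P t) F t) g = \sum_(t | P t) F t g.
Proof. by rewrite sum_ffunE. Qed.

Lemma barE g (h : kQ) g' : bar g h g' = if g' == g then h else 0.
Proof. by rewrite ffunE. Qed.

Lemma kQ_expand_supp (T : finType) (F : T -> PathQ len) (x : kQ) : injective F ->
  (forall q, x q != 0 -> exists t, q = F t) -> x = \sum_t x (F t) *: pv (F t).
Proof.
move=> injF suppx; apply/ffunP=> q; rewrite kQ_sumE.
have [xq0|xq] := eqVneq (x q) 0.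
  rewrite xq0 big1 // => t _; rewrite kQ_scaleE pvE.
  by case: eqP => [<-|_]; rewrite ?xq0 ?mulr0 ?mul0r.
have [t ->] := suppx q xq.
rewrite (bigD1 t) // kQ_scaleE pvE eqxx mulr1 big1 /= ?addr0 // => t' ne.
by rewrite kQ_scaleE pvE (inj_eq injF) eq_sym (negPf ne) mulr0.
Qed.

Lemma kmulDl (u v w : kQ) : kmul (u + v) w = kmul u w + kmul v w.
Proof.
rewrite /kmul -big_split; apply: eq_bigr => q1 _.
rewrite -big_split; apply: eq_bigr => q2 _.
by rewrite ffunE mulrDl scalerDl.
Qed.

Lemma kmulDr (u v w : kQ) : kmul w (u + v) = kmul w u + kmul w v.
Proof.
rewrite /kmul -big_split; apply: eq_bigr => q1 _.
rewrite -big_split; apply: eq_bigr => q2 _.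
by rewrite ffunE mulrDr scalerDl.
Qed.

Lemma kmulZl c (u v : kQ) : kmul (c *: u) v = c *: kmul u v.
Proof.
rewrite /kmul scaler_sumr; apply: eq_bigr => q1 _.
rewrite scaler_sumr; apply: eq_bigr => q2 _.
by rewrite kQ_scaleE scalerA mulrA.
Qed.

Lemma kmulZr c (u v : kQ) : kmul u (c *: v) = c *: kmul u v.
Proof.
rewrite /kmul scaler_sumr; apply: eq_bigr => q1 _.
rewrite scaler_sumr; apply: eq_bigr => q2 _.
by rewrite kQ_scaleE scalerA mulrCA.
Qed.

Lemma kmul0l (v : kQ) : kmul 0 v = 0.
Proof. by have := kmulZl 0 0 v; rewrite !scale0r. Qed.

Lemma kmul0r (v : kQ) : kmul v 0 = 0.
Proof. by have := kmulZr 0 v 0; rewrite !scale0r. Qed.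

Lemma kmul_suml (T : finType) (F : T -> kQ) v : kmul (\sum_t F t) v = \sum_t kmul (F t) v.
Proof. by apply: (big_morph (fun u => kmul u v)) => [u u'|]; rewrite ?kmulDl ?kmul0l. Qed.

Lemma kmul_sumr (T : finType) (F : T -> kQ) v : kmul v (\sum_t F t) = \sum_t kmul v (F t).
Proof. by apply: (big_morph (kmul v)) => [u u'|]; rewrite ?kmulDr ?kmul0r. Qed.

Lemma kmul_pv (q1 q2 : PathQ len) : kmul (pv q1) (pv q2) = optv k (mulP q1 q2).
Proof.
transitivity (\sum_q (q == q1)%:R *: \sum_q' (q' == q2)%:R *: optv k (mulP q q')).
  apply: eq_bigr => q _; rewrite scaler_sumr; apply: eq_bigr => q' _.
  by rewrite !pvE scalerA.
by rewrite !sum_delta_scale.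
Qed.

Lemma kmul_pv3 (q1 q q2 : PathQ len) :
  kmul (kmul (pv q1) (pv q)) (pv q2)
  = optv k (if mulP q1 q is Some m then mulP m q2 else None).
Proof. by rewrite kmul_pv; case: (mulP q1 q) => [m|] /=; rewrite ?kmul_pv ?kmul0l. Qed.

Lemma brvE b : brv k len b = pv (pb b).
Proof.
rewrite /brv (big_pred1 (brpath len_gt0 b)) // => p /=.
apply/andP/eqP => [[/andP[/eqP <- /eqP e1] /eqP e2]|->].
  exact: path_source_sink.
by rewrite pfst_brpath abr_firstarr psrc_brpath ptgt_brpath !eqxx.
Qed.

Lemma pb_inj : injective (fun b => pb b).
Proof.
move=> b b' e; apply: (@brpath_inj _ _ len_gt0).
exact: (congr1 (fun q : PathQ len => if q is inr p then p else brpath len_gt0 b) e).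
Qed.

Lemma brv_pb b b' : brv k len b (pb b') = (b' == b)%:R.
Proof. by rewrite brvE pvE (inj_eq pb_inj). Qed.

(** * Values of bimodule maps on arrows *)

Lemma len1_first (g : Arr len) : len (abr g) = 1%N -> g = firstarr len_gt0 (abr g).
Proof.
move=> e; apply/eqP; rewrite -first_arr eqxx /=.
by have := aidx_lt g; rewrite e; case: (aidx g).
Qed.

Lemma brpath_len1 b : len b = 1%N -> brpath len_gt0 b = arrpath (firstarr len_gt0 b).
Proof. by move=> e; apply: path_inj => //; apply: arr_inj => //=; rewrite aidx_lastarr e. Qed.

(** There are no loops, so no trivial path is parallel to [g], and the only nontrivial one is [g]
    itself. *)
Lemma homE_long (f : W) g : homE f -> (1 < len (abr g))%N ->
  f g = f g (pa g) *: pv (pa g).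
Proof.
move=> hf lg.
have := @kQ_expand_supp unit (fun _ => pa g) (f g) (fun x y _ => _).
rewrite big_const card_unit /= addr0; apply; first by case=> [] [].
move=> q /hf /andP[/eqP e1 /eqP e2]; exists tt.
case: q e1 e2 => [x|p] /= e1 e2.
  by have /eqP[] := asrc_neq_atgt len_gt0 g; rewrite -e1 -e2.
by rewrite (path_parallel_arrow len_gt0 lg e1 e2).
Qed.

(** An arrow of [Z] goes from the source to the sink, so its parallel paths are exactly the
    branches. *)
Lemma homE_Z (f : W) g : homE f -> len (abr g) = 1%N ->
  f g = \sum_b f g (pb b) *: brv k len b.
Proof.
move=> hf lg; under eq_bigr do rewrite brvE.
apply: kQ_expand_supp; first exact: pb_inj.
move=> q /hf /andP[/eqP e1 /eqP e2].
case: q e1 e2 => [x|p] /= e1 e2.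
  by have /eqP[] := asrc_neq_atgt len_gt0 g; rewrite -e1 -e2.
exists (abr (pfst p)); congr inr; apply: path_source_sink.
  by rewrite e1 (len1_first lg).
by rewrite e2; apply/eqP; rewrite atgt_eqomega // lg eqSS {1}(len1_first lg).
Qed.

(* For b of length > 1, f scales every arrow g of the branch b, by f g (pa g), so D_1 f
   scales every path of b by the sum of these factors. *)
Definition eig (f : W) (p : Path len) : k :=
  \sum_(g : Arr len | (abr g == abr (pfst p)) && (aidx (pfst p) <= aidx g <= aidx (plst p))%N)
     f g (pa g).

Lemma arrow_factor_bounds (p : Path len) q1 g q2 r :
  mulP q1 (pa g) = Some r -> mulP r q2 = Some (inr p) ->
  (abr g == abr (pfst p)) && (aidx (pfst p) <= aidx g <= aidx (plst p))%N.
Proof.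
move=> E1 E2; have [l1 l2] := mulP3P E1 E2.
have [-> ->] : abr (pfst p) = abr g /\ (aidx (pfst p) <= aidx g)%N.
  case: (q1) l1 => [x|u] /= [e1 e2]; first by rewrite e2.
  have [e3 e4] := atgt_asrc len_gt0 e1; rewrite e2 -path_abr e3; split=> //.
  by rewrite -e4 ltnW // ltnS path_aidx.
rewrite eqxx /=.
case: (q2) l2 => [x|u] /= [e1 e2]; first by rewrite e2.
have [e3 e4] := atgt_asrc len_gt0 e1; rewrite e2.
by apply: leq_trans (path_aidx u); rewrite -e4.
Qed.

(** Grouping by the middle arrow leaves one triple for each arrow of [p], since its two cofactors
    exist and are unique. *)
Lemma sum_arrow_factors (p : Path len) (F : Arr len -> k) :
  \sum_(t : PathQ len * Arr len * PathQ len |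
     if mulP t.1.1 (pa t.1.2) is Some m then mulP m t.2 == Some (inr p) else false) F t.1.2
  = \sum_(g | (abr g == abr (pfst p)) && (aidx (pfst p) <= aidx g <= aidx (plst p))%N) F g.
Proof.
rewrite (partition_big (fun t : PathQ len * Arr len * PathQ len => t.1.2)
  (fun g : Arr len => (abr g == abr (pfst p)) &&
     (aidx (pfst p) <= aidx g <= aidx (plst p))%N)) /=; last first.
  move=> [[q1 g] q2] /=; case E: (mulP q1 _) => [r|//] /eqP E2.
  exact: arrow_factor_bounds E E2.
apply: eq_bigr => g /andP[/eqP gb /andP[g1 g2]].
have [q1 [q2 [r [E1 E2]]]] := @mulP3_exists _ _ (arrpath g) p (esym gb) g1 g2.
have [l1 l2] := mulP3P E1 E2.
rewrite (big_pred1 (q1, g, q2)) // => -[[q1' g'] q2'] /=.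
apply/andP/eqP => [[+ /eqP eg]|[-> -> ->]]; last by rewrite E1 E2 !eqxx.
rewrite {g'}eg; case E: (mulP q1' _) => [r'|//] /eqP E'.
have [l1' l2'] := mulP3P E E'.
by rewrite (left_cofactor_inj len_gt0 l1' l1) (right_cofactor_inj len_gt0 l2' l2).
Qed.

Lemma D1path_long (f : W) (p : Path len) : homE f -> (1 < len (abr (pfst p)))%N ->
  D1path f (inr p) = eig f p *: pv (inr p).
Proof.
move=> hf lp; rewrite /eig -sum_arrow_factors scaler_suml.
apply: eq_bigr => -[[q1 g] q2] /=; case E: (mulP q1 _) => [r|//] /eqP E2.
have /andP[/eqP gb _] := arrow_factor_bounds E E2.
by rewrite [in LHS]homE_long ?gb // kmulZr kmulZl kmul_pv3 E E2.
Qed.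

(** For a branch of length greater than 1, this is the scalar [C_b(f)]. *)
Definition branch_eig (f : W) b : k := \sum_(g : Arr len | abr g == b) f g (pa g).

Lemma branch_eig_sum (T : finType) P (c : T -> k) (F : T -> W) b :
  branch_eig (\sum_(t | P t) c t *: F t) b = \sum_(t | P t) c t * branch_eig (F t) b.
Proof.
under [RHS]eq_bigr do rewrite mulr_sumr.
rewrite exchange_big; apply: eq_bigr => g _; rewrite W_sumE kQ_sumE.
by apply: eq_bigr => t _; rewrite W_scaleE kQ_scaleE.
Qed.

Lemma branch_eigB (f f' : W) b : branch_eig (f - f') b = branch_eig f b - branch_eig f' b.
Proof. by rewrite -sumrB; apply: eq_bigr => g _; rewrite W_subE kQ_subE. Qed.

Lemma eig_brpath f b : eig f (brpath len_gt0 b) = branch_eig f b.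
Proof.
apply: eq_bigl => g; rewrite abr_firstarr; case: eqP => //= gb.
by rewrite -ltnS prednK // -gb aidx_lt.
Qed.

Lemma D1path_br f b : homE f -> (1 < len b)%N ->
  D1path f (pb b) = branch_eig f b *: brv k len b.
Proof. by move=> hf lb; rewrite D1path_long // eig_brpath brvE. Qed.

(** * The differential [D1] on combinations of branches *)

Lemma D1_pv f q : D1 f (pv q) = D1path f q.
Proof.
rewrite -[RHS](sum_delta_scale (D1path f)); apply: eq_bigr => q' _.
by rewrite pvE.
Qed.

Lemma D1Z f c (u : kQ) : D1 f (c *: u) = c *: D1 f u.
Proof.
rewrite /D1 scaler_sumr; apply: eq_bigr => q _.
by rewrite kQ_scaleE scalerA.
Qed.

Lemma D1_sum (T : finType) f (F : T -> kQ) : D1 f (\sum_t F t) = \sum_t D1 f (F t).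
Proof.
rewrite /D1 exchange_big; apply: eq_bigr => q _.
by rewrite kQ_sumE scaler_suml.
Qed.

Lemma D1_br (T : 'I_n.+1 -> k) f : homE f -> (forall b, T b != 0 -> (1 < len b)%N) ->
  D1 f (\sum_b T b *: brv k len b) = \sum_b (T b * branch_eig f b) *: brv k len b.
Proof.
move=> hf hT; rewrite D1_sum; apply: eq_bigr => b _; rewrite D1Z.
have [->|Tb] := eqVneq (T b) 0; first by rewrite mul0r !scale0r.
by rewrite -scalerA -D1path_br ?hT // -D1_pv brvE.
Qed.

(** * The differential [D0] and telescoping along branches *)

Lemma bar_sum (P : pred (Arr len)) (F : Arr len -> kQ) g :
  (\sum_(g' | P g') bar g' (F g')) g = if P g then F g else 0.
Proof.
rewrite W_sumE; under eq_bigr do rewrite barE.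
rewrite -big_mkcondr; case: ifP => Pg; [apply: big_pred1 => g' | apply: big_pred0 => g'].
  by rewrite eq_sym andbC /=; case: eqP => // ->.
by rewrite eq_sym andbC; case: eqP => // ->.
Qed.

Lemma D0E x g : D0 k x g = ((atgt g == x)%:R - (asrc g == x)%:R) *: pv (pa g).
Proof.
rewrite W_subE !bar_sum scalerBl.
by do 2!case: eqP => _; rewrite ?scale1r ?scale0r.
Qed.

(** [c] acts as a potential on vertices: its coboundary multiplies each arrow by the increase of [c]
    along it. *)
Lemma D0_sum (c : Vert len -> k) g :
  (\sum_x c x *: D0 k x) g = (c (atgt g) - c (asrc g)) *: pv (pa g).
Proof.
rewrite W_sumE; under eq_bigr do rewrite W_scaleE D0E scalerA.
rewrite -scaler_suml; congr (_ *: _).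
by under eq_bigr do rewrite mulrBr; rewrite sumrB !sum_mul_delta.
Qed.

Lemma sum_branch_arrows b (F : Arr len -> k) :
  \sum_(g | abr g == b) F g = \sum_(m < len b) F (existT (fun b => 'I_(len b)) b m).
Proof.
transitivity (\sum_(b' | b' == b) \sum_(m < len b')
    F (existT (fun b => 'I_(len b)) b' m)); last first.
  by rewrite big_pred1_eq.
rewrite sig_big_dep /=.
by apply: eq_big => [[b' m]|[b' m] _]; rewrite /= ?andbT.
Qed.

Lemma telescope_branch b (c : Vert len -> k) :
  \sum_(g | abr g == b) (c (atgt g) - c (asrc g)) = c (vomega len) - c (v0 len).
Proof.
rewrite sum_branch_arrows -(big_mkord xpredT (fun m => c (vpos len b m.+1) - c (vpos len b m))).
by rewrite telescope_sumr // (vpos_len len_gt0).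
Qed.

(** Partial sums along a branch serve below as a potential; this is their increment along [g]. *)
Lemma sum_below_step (F : Arr len -> k) g :
  \sum_(h | (abr h == abr g) && (aidx h < (aidx g).+1)%N) F h
  = F g + \sum_(h | (abr h == abr g) && (aidx h < aidx g)%N) F h.
Proof.
rewrite (bigD1 g) /= ?eqxx ?ltnSn //; congr (_ + _); apply: eq_bigl => h.
rewrite -andbA; case: eqP => //= eb; rewrite ltnS ltn_neqAle andbC; congr (~~ _ && _).
by apply/eqP/eqP => [->//|]; apply: arr_inj.
Qed.

Lemma homE_scale_pa (c : Arr len -> k) : homE [ffun g => c g *: pv (pa g)].
Proof.
move=> g q; rewrite ffunE kQ_scaleE pvE; case: (q =P pa g) => [->|]; last by rewrite mulr0 eqxx.
by rewrite /= /psrc /ptgt /= !eqxx.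
Qed.

Lemma homE_sub (f f' : W) : homE f -> homE f' -> homE (f - f').
Proof.
move=> hf hf' g q; rewrite W_subE kQ_subE => fg.
have [f0|/hf//] := eqVneq (f g q) 0; apply: hf'.
by apply: contraNneq fg => f'0; rewrite f0 f'0 subrr.
Qed.

(** * Bases of a quotient, with coefficients on a finite type *)

Lemma sum_tnth_map (J : finType) (T : Type) (F : J -> T) (V : nmodType) (G : J -> V) s :
  uniq s ->
  \sum_i G (tnth (in_tuple s) (cast_ord (size_map F s) i)) = \sum_(j in s) G j.
Proof.
move=> us; rewrite -big_uniq // big_tnth [RHS](reindex (cast_ord (size_map F s))) //=.
by apply: onW_bij; exists (cast_ord (esym (size_map F s))); [exact: cast_ordK | exact: cast_ordKV].
Qed.

(** Coefficients on a finite type, instead of on positions in a list, can be chosen by cases. Only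
    the indices are required to be distinct, not their images under [F]. *)
Lemma quot_basis_map (J : finType) (F : J -> W) (s : seq J) (inK inIm : W -> Prop) :
  uniq s -> (forall j, j \in s -> inK (F j)) ->
  (forall f, inK f -> exists c : J -> k, inIm (f - \sum_(j in s) c j *: F j)) ->
  (forall c : J -> k, inIm (\sum_(j in s) c j *: F j) -> forall j, j \in s -> c j = 0) ->
  quot_basis inK inIm [seq F j | j <- s].
Proof.
move=> us hK hgen hfree.
pose e (i : 'I_(size [seq F j | j <- s])) := tnth (in_tuple s) (cast_ord (size_map F s) i).
have es i : e i \in s by exact: mem_tnth.
have Fe i : [seq F j | j <- s]`_(val i) = F (e i).
  rewrite (nth_map (e i)); last by rewrite -(size_map F s) ltn_ord.
  by rewrite [in RHS]/e (tnth_nth (e i)).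
have sumE (c : J -> k) : \sum_i c (e i) *: [seq F j | j <- s]`_(val i) = \sum_(j in s) c j *: F j.
  rewrite -(sum_tnth_map F (fun j => c j *: F j) us).
  by apply: eq_bigr => i _; rewrite Fe.
split=> [i|]; first by rewrite Fe; exact: hK.
split=> [f /hgen[c hc]|c hc i].
  by exists (c \o e); rewrite sumE.
(* Moves the coefficients from positions to indices, with value 0 outside [s], where [index] is out
   of range. *)
pose c' j := oapp c 0 (insub (index j s)).
have c'e i' : c' (e i') = c i'.
  have -> : c i' = oapp c 0 (insub (val i')) by rewrite valK.
  rewrite /c' /e (tnth_nth (e i')) index_uniq //= -(size_map F s) ltn_ord //.
rewrite -c'e; apply: hfree (es i).
by rewrite -sumE; under eq_bigr do rewrite c'e.
Qed.

End PathAlgebra.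

(** * Cocycles, coboundaries and the basis *)

Section ToupieAlgebra.
Set Implicit Arguments. Unset Strict Implicit. Unset Printing Implicit Defensive.
Variables (k : fieldType) (n : nat) (len : 'I_n.+1 -> nat) (nm nn : nat).
Variables (mono : 'I_nm -> Path len) (rho : 'I_nn -> {ffun 'I_n.+1 -> k}).
Variable piv : 'I_nn -> 'I_n.+1.
Hypothesis len_gt0 : forall b, (0 < len b)%N.
Hypothesis adm : admissible (Iid mono rho).
Hypothesis rref_rho : rref rho piv.
Hypothesis num : numbering mono rho.

Local Notation kQ := (kQ k len).
Local Notation W := (W k len).
Local Notation pv := (@pv k n len).
Local Notation brv := (brv k len).
Local Notation pb b := (inr (brpath len_gt0 b) : PathQ len).
Local Notation pa g := (inr (arrpath g) : PathQ len).
Local Notation I := (Iid mono rho).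
Local Notation hasMono := (hasMono mono).

(** * The relations and the ideal [I] *)

Lemma rho_piv i j : rho i (piv j) = (i == j)%:R.
Proof.
case: rref_rho => h1 _ _ h4; case: eqVneq => [->|ne]; first exact: h1.
by rewrite h4 // eq_sym.
Qed.

Lemma rho_hasMono i b : rho i b != 0 -> ~~ hasMono b.
Proof.
move=> rb; case: num => /(_ b) + _; apply: contra => ->.
by apply/existsP; exists i.
Qed.

Lemma piv_hasMono i : ~~ hasMono (piv i).
Proof. by apply: (@rho_hasMono i); rewrite rho_piv eqxx oner_neq0. Qed.

Lemma gen_mem j q1 q2 : kmul (kmul (pv q1) (relR mono rho j)) (pv q2) \in I.
Proof.
apply: memv_span; apply/flatten_mapP; exists (relR mono rho j).
  by apply: map_f; rewrite mem_enum.
apply: (allpairs_f (fun q1 q2 => kmul (kmul (pv q1) (relR mono rho j)) (pv q2)));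
  by rewrite mem_enum.
Qed.

Lemma mono_mem i : pv (inr (mono i)) \in I.
Proof.
have := gen_mem (inl i) (inl (psrc (mono i))) (inl (ptgt (mono i))).
by rewrite /= kmul_pv3 /= eqxx /= eqxx.
Qed.

Lemma rhov_mem i : rhov len rho i \in I.
Proof.
have := gen_mem (inr i) (inl (v0 len)) (inl (vomega len)).
rewrite /= /rhov kmul_sumr kmul_suml; congr (_ \in I); apply: eq_bigr => b _.
rewrite kmulZr kmulZl (brvE k len_gt0) kmul_pv3; congr (_ *: _).
have /eqP e1 := psrc_brpath len_gt0 b; have /eqP e2 := ptgt_brpath len_gt0 b.
by rewrite /mulP eq_sym e1 e2.
Qed.

(** The whole branch is a two-sided multiple of the monomial relation inside it. *)
Lemma brv_mem b : hasMono b -> brv b \in I.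
Proof.
case/existsP=> i /eqP mb.
have [|||q1 [q2 [r [E1 E2]]]] := @mulP3_exists _ _ (mono i) (brpath len_gt0 b).
- by rewrite pfst_brpath abr_firstarr mb.
- by rewrite pfst_brpath aidx_firstarr.
- by rewrite plst_brpath aidx_lastarr -ltnS prednK // -mb -path_abr aidx_lt.
have := gen_mem (inl i) q1 q2.
by rewrite /= kmul_pv3 E1 E2 (brvE k len_gt0).
Qed.

(** A multiple of a monomial relation is zero or a path on the same branch. *)
Lemma mono_factor_coord q1 i q2 s : ~~ hasMono s ->
  kmul (kmul (pv q1) (pv (inr (mono i)))) (pv q2) (pb s) = 0.
Proof.
move=> ms; rewrite kmul_pv3.
case E1: (mulP q1 _) => [r|] /=; last by rewrite ffunE.
case E2: (mulP r q2) => [q|] /=; last by rewrite ffunE.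
rewrite pvE; case: eqP => // eq; case/negP: ms; apply/existsP; exists i; apply/eqP.
rewrite -{q}eq in E2; have [l1 _] := mulP3P E1 E2.
move: l1; rewrite -[RHS](abr_firstarr len_gt0) -pfst_brpath.
case: q1 {E1} => [x|u] [e1 ->] //.
by have [<- _] := atgt_asrc len_gt0 e1; rewrite path_abr.
Qed.

(** A full branch can only be multiplied by the trivial paths at its ends, because no arrow ends at
    the source or starts at the sink. *)
Lemma branch_factor_coord q1 b q2 s :
  kmul (kmul (pv q1) (brv b)) (pv q2) (pb s)
  = ((q1 == inl (v0 len)) && (q2 == inl (vomega len)))%:R * (s == b)%:R.
Proof.
rewrite (brvE k len_gt0) kmul_pv3.
have /eqP e1 := psrc_brpath len_gt0 b; have /eqP e2 := ptgt_brpath len_gt0 b.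
case: (boolP (_ && _)) => [/andP[/eqP-> /eqP->]|ne].
  rewrite /mulP eq_sym e1 e2 /= pvE (inj_eq (@pb_inj _ _ len_gt0)).
  by rewrite mul1r.
rewrite mul0r.
case E1: (mulP q1 _) => [r|] /=; last by rewrite ffunE.
case E2: (mulP r q2) => [q|] /=; last by rewrite ffunE.
rewrite pvE; case: eqP => // eq; rewrite -{q}eq in E2.
have [l1 l2] := mulP3P E1 E2; case/negP: ne.
case: q1 l1 {E1} => [x|u] [h1 _]; last first.
  by move: h1; rewrite (eqP e1) => /eqP; rewrite atgt_neq0.
case: q2 l2 {E2} => [y|u] [h2 _]; last first.
  by move: h2; rewrite (eqP e2) => /esym/eqP; rewrite asrc_neqomega.
by rewrite h1 h2 (eqP e1) (eqP e2) !eqxx.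
Qed.

(* Coordinate of the normal form of the 0-omega component of x modulo I at a
   branch s without monomial relations; it vanishes when s is a pivot. *)
Definition nfc (x : kQ) s : k := x (pb s) - \sum_i x (pb (piv i)) * rho i s.

Lemma nfc_sum (T : finType) P (c : T -> k) (F : T -> kQ) s :
  nfc (\sum_(t | P t) c t *: F t) s = \sum_(t | P t) c t * nfc (F t) s.
Proof.
under [RHS]eq_bigr do rewrite mulrBr mulr_sumr.
rewrite sumrB exchange_big /nfc kQ_sumE; congr (_ - _).
  by apply: eq_bigr => t _; rewrite kQ_scaleE.
apply: eq_bigr => i _; rewrite kQ_sumE mulr_suml; apply: eq_bigr => t _.
by rewrite kQ_scaleE mulrA.
Qed.

(** It suffices to test the spanning products. Multiples of monomial relations miss both [s] and the
    pivots. A multiple of [rhov i] has branch coordinates proportional to [rho i], whose pivot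
    entries form a row of the identity matrix, so the pivot correction cancels the entry at [s]. *)
Lemma Iid_nfc x s : x \in I -> ~~ hasMono s -> nfc x s = 0.
Proof.
pose G := flatten [seq [seq kmul (kmul (pv q1) g) (pv q2)
   | q1 <- enum (PathQ len), q2 <- enum (PathQ len)] | g <- Rseq mono rho].
move=> xI ms; have {xI} xG : x \in <<in_tuple G>>%VS by [].
rewrite (coord_span xG) nfc_sum big1 // => t _.
set g := _`_t; suff -> : nfc g s = 0 by rewrite mulr0.
have : g \in in_tuple G by exact: mem_nth.
case/flatten_mapP => r /mapP[j _ ->{r}] /allpairsP[[q1 q2] [_ _ ->]] /=.
case: j => [i|i] /=.
  rewrite /nfc mono_factor_coord // big1 ?subr0 // => i' _.
  by rewrite mono_factor_coord ?mul0r // piv_hasMono.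
have E s' : kmul (kmul (pv q1) (rhov len rho i)) (pv q2) (pb s')
    = ((q1 == inl (v0 len)) && (q2 == inl (vomega len)))%:R * rho i s'.
  rewrite /rhov kmul_sumr kmul_suml kQ_sumE.
  under eq_bigr do rewrite kmulZr kmulZl kQ_scaleE branch_factor_coord mulrCA.
  by rewrite -mulr_sumr sum_mul_delta.
rewrite /nfc E; under eq_bigr do rewrite E rho_piv -mulrA.
rewrite -mulr_sumr -mulrBr; apply/eqP; rewrite mulf_eq0 subr_eq0; apply/orP; right.
by under eq_bigr do rewrite mulrC; rewrite (sum_mul_delta (fun t => rho t s)).
Qed.

Lemma sum_brv_coord (c : 'I_n.+1 -> k) s : (\sum_b c b *: brv b) (pb s) = c s.
Proof.
rewrite kQ_sumE; under eq_bigr do rewrite kQ_scaleE brv_pb.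
exact: sum_mul_delta.
Qed.

(** Converse of [Iid_nfc] for combinations of branches: clearing the pivots with the [rhov i] leaves
    the coefficients [nfc]. These vanish by assumption except on branches with monomial relations,
    which lie in [I]. *)
Lemma sum_brv_mem (c : 'I_n.+1 -> k) :
  (forall s, ~~ hasMono s -> nfc (\sum_b c b *: brv b) s = 0) -> \sum_b c b *: brv b \in I.
Proof.
move=> h.
have -> : \sum_b c b *: brv b = \sum_i c (piv i) *: rhov len rho i
    + \sum_b nfc (\sum_b c b *: brv b) b *: brv b.
  under [X in X + _]eq_bigr do rewrite scaler_sumr.
  rewrite exchange_big -big_split /=; apply: eq_bigr => b _.
  under eq_bigr do rewrite scalerA.
  rewrite -scaler_suml -scalerDl /nfc sum_brv_coord.
  by under [X in _ - X]eq_bigr do rewrite sum_brv_coord; rewrite addrC subrK.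
apply: memvD; apply: memv_suml => t _; first exact/memvZ/rhov_mem.
case: (boolP (hasMono t)) => [/brv_mem|/h ->]; first exact: memvZ.
by rewrite scale0r mem0v.
Qed.

(** * Consequences of admissibility *)

Lemma Iid_arr x g : x \in I -> x (pa g) = 0.
Proof.
case: adm => h _ /h /(_ (pa g)) h'; apply/eqP; apply: contraT => /h'.
by rewrite /= /plen subnn.
Qed.

Lemma qlen_pb b : qlen (pb b) = len b.
Proof. by rewrite /= /plen subn0 plst_brpath aidx_lastarr prednK. Qed.

(** A relation involves only paths of length at least 2, so no arrow of [Z] takes part in a
    non-monomial one. *)
Lemma rho_len i b : rho i b != 0 -> (1 < len b)%N.
Proof.
case: adm => h _ rb; have := h _ (rhov_mem i) (pb b).
by rewrite /rhov sum_brv_coord qlen_pb; apply.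
Qed.

Lemma mono_len i : (1 < len (abr (pfst (mono i))))%N.
Proof.
case: adm => h _; have := h _ (mono_mem i) (inr (mono i)).
rewrite pvE eqxx oner_neq0 => /(_ isT) /=; rewrite /plen ltnS -path_abr => l.
by apply: leq_ltn_trans (aidx_lt (plst (mono i))); apply: leq_trans l (leq_subr _ _).
Qed.

Lemma hasMono_len b : hasMono b -> (1 < len b)%N.
Proof. by case/existsP=> i /eqP <-; apply: mono_len. Qed.

(** [D1] scales a monomial relation, which therefore stays in [I]. In [rhov i] it scales the branch
    [b] by [branch_eig f b], and the result lies in [I] iff on the support all these scalars equal
    the one at the pivot. *)
Lemma inKerP (f : W) : homE f ->
  (forall i b, rho i b != 0 -> branch_eig f b = branch_eig f (piv i)) <-> inKer mono rho f.
Proof.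
move=> hf.
have D1rho i : D1 f (rhov len rho i) = \sum_b (rho i b * branch_eig f b) *: brv b.
  by apply: (D1_br len_gt0) => // b /rho_len.
split=> [h|[_ h] i b rb].
  split=> // -[i|i] /=.
    by rewrite D1_pv (D1path_long len_gt0) ?mono_len // memvZ ?mono_mem.
  rewrite D1rho; have -> : \sum_b (rho i b * branch_eig f b) *: brv b
      = branch_eig f (piv i) *: rhov len rho i.
    rewrite scaler_sumr; apply: eq_bigr => b _; rewrite scalerA mulrC.
    by have [->|/h ->] := eqVneq (rho i b) 0; rewrite ?mulr0.
  by rewrite memvZ ?rhov_mem.
(* In normal form, the coordinate at [b] is [rho i b] times the difference of the scalars at [b] and
   at the pivot. *)
have := Iid_nfc (h (inr i)) (rho_hasMono rb).
rewrite /= D1rho /nfc sum_brv_coord.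
under eq_bigr do rewrite sum_brv_coord rho_piv -mulrA mulrC.
rewrite (sum_mul_delta (fun j => branch_eig f (piv j) * rho j b)) [_ * rho i b]mulrC.
by rewrite -mulrBr => /eqP; rewrite mulf_eq0 (negPf rb) subr_eq0 => /eqP.
Qed.

Lemma nfcB (x y : kQ) s : nfc (x - y) s = nfc x s - nfc y s.
Proof.
rewrite /nfc kQ_subE; under eq_bigr do rewrite kQ_subE mulrBl.
by rewrite sumrB !opprB addrACA [RHS]addrACA; congr (_ + _); rewrite addrC.
Qed.

Lemma nfcZ a (x : kQ) s : nfc (a *: x) s = a * nfc x s.
Proof.
rewrite mulrBr mulr_sumr /nfc kQ_scaleE; congr (_ - _).
by apply: eq_bigr => i _; rewrite kQ_scaleE mulrA.
Qed.

Lemma nfc_brv b s : (forall i, piv i != b) -> nfc (brv b) s = (s == b)%:R.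
Proof.
move=> pb; rewrite /nfc brv_pb big1 ?subr0 // => i _.
by rewrite brv_pb (negPf (pb i)) mul0r.
Qed.

Lemma inZ_piv u : inZ len u -> forall i, piv i != u.
Proof.
move=> /eqP lu i; apply/eqP => e; have := @rho_len i u.
by rewrite -e rho_piv eqxx oner_neq0 e lu => /(_ isT).
Qed.

Lemma pv_firstarr u : inZ len u -> pv (pa (firstarr len_gt0 u)) = brv u.
Proof. by move=> /eqP lu; rewrite (brvE k len_gt0) brpath_len1. Qed.

Lemma inImgP (f : W) : homE f ->
  (exists lam : k, (forall b, (1 < len b)%N -> branch_eig f b = lam) /\
     (forall u s, inZ len u -> ~~ hasMono s ->
        nfc (f (firstarr len_gt0 u)) s = lam * (s == u)%:R))
  <-> inImg mono rho f.
Proof.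
move=> hf; split=> [[lam [hb hZ]]|[c [_ hc]]]; last first.
  exists (c (vomega len) - c (v0 len)); split=> [b lb|u s uZ ms].
    rewrite -(telescope_branch len_gt0 b); apply: eq_bigr => g /eqP gb.
    have := Iid_arr g (hc g); rewrite W_subE D0_sum kQ_subE kQ_scaleE pvE eqxx.
    by rewrite mulr1 => /eqP; rewrite subr_eq0 => /eqP.
  have := Iid_nfc (hc (firstarr len_gt0 u)) ms.
  rewrite W_subE D0_sum nfcB nfcZ pv_firstarr // nfc_brv; last exact: inZ_piv.
  move/eqP; rewrite subr_eq0 => /eqP ->.
  have -> : atgt (firstarr len_gt0 u) = vomega len by apply/eqP; rewrite atgt_eqomega // eq_sym.
  by have -> : asrc (firstarr len_gt0 u) = v0 len by [].
(* [S b m] sums the scalars of the first [m] arrows of [b]. As a potential it starts from 0 at the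
   source, and [hb] makes all branches of length greater than 1 agree on the value [lam] at the
   sink. *)
pose S b m := \sum_(h | (abr h == b) && (aidx h < m)%N) f h (pa h).
pose c (v : Vert len) : k := match v with
  | None => 0 | Some None => lam
  | Some (Some w) => S (abr (val w)) (aidx (val w)) end.
have cS b m : (1 < len b)%N -> (m <= len b)%N -> c (vpos len b m) = S b m.
  move=> lb lm; case: (vposP len_gt0 lm) => [->|->|v _ vb vm] /=; last by rewrite vb vm.
    by rewrite /S big1 // => h /andP[_]; rewrite ltn0.
  rewrite -(hb b lb) /S; apply: eq_bigl => h.
  by case: eqP => //= <-; rewrite aidx_lt.
have D g : (f - \sum_x c x *: D0 k x) g = f g - (c (atgt g) - c (asrc g)) *: pv (pa g).
  by rewrite W_subE D0_sum.
exists c; split=> [|g].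
  have -> : f - \sum_x c x *: D0 k x
      = f - [ffun g => (c (atgt g) - c (asrc g)) *: pv (pa g)].
    by apply/ffunP => g; rewrite D W_subE ffunE.
  exact/homE_sub/homE_scale_pa.
rewrite D; have [lg|] := ltnP 1 (len (abr g)).
  (* On a longer branch the potential increases by the scalar of [f] at [g], so the difference is
     zero already in [kQ]. *)
  rewrite /atgt /asrc !cS ?aidx_lt // ?(ltnW (aidx_lt g)) // /S sum_below_step addrK.
  by rewrite -(homE_long len_gt0) // subrr mem0v.
(* Only arrows of [Z] remain; there the potential increases by [lam], and [hZ] compares normal
   forms. *)
rewrite leq_eqVlt ltnS leqNgt len_gt0 orbF => /eqP lg.
have gZ : inZ len (abr g) by rewrite /inZ lg.
have -> : c (atgt g) = lam.
  have -> : atgt g = vomega len; last by [].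
  by apply/eqP; rewrite atgt_eqomega // (len1_first len_gt0 lg) lg.
have -> : c (asrc g) = 0 by rewrite (len1_first len_gt0 lg).
rewrite subr0 (homE_Z len_gt0 hf lg) [g in pa g](len1_first len_gt0 lg) pv_firstarr //.
have E : \sum_b f g (pb b) *: brv b - lam *: brv (abr g)
   = \sum_b (f g (pb b) - lam * (b == abr g)%:R) *: brv b.
  under [RHS]eq_bigr do rewrite scalerBl -scalerA.
  by rewrite sumrB -scaler_sumr sum_delta_scale.
rewrite E; apply: sum_brv_mem => s ms; rewrite -E nfcB nfcZ nfc_brv; last exact: inZ_piv.
rewrite -(hZ (abr g) s gZ ms) -(len1_first len_gt0 lg).
by rewrite [X in _ - nfc X _](homE_Z len_gt0 hf lg) subrr.
Qed.

(** * Coordinates of cochains and of the elements of the families *)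

Local Notation inZ := (inZ len).
Local Notation erho := (erho mono rho).
Local Notation comps := (comps mono rho).
Local Notation inVrho := (inVrho mono).

(** For [u] in [Z], an entry of the matrix of [f] on [Z], with values in normal form modulo [I]. *)
Definition zcoord (f : W) u s : k := nfc (f (firstarr len_gt0 u)) s.

Lemma zcoordB (f f' : W) u s : zcoord (f - f') u s = zcoord f u s - zcoord f' u s.
Proof. by rewrite /zcoord W_subE nfcB. Qed.

Lemma zcoord_sum (T : finType) P (c : T -> k) (F : T -> W) u s :
  zcoord (\sum_(t | P t) c t *: F t) u s = \sum_(t | P t) c t * zcoord (F t) u s.
Proof.
rewrite -nfc_sum /zcoord W_sumE; congr (nfc _ s).
by apply: eq_bigr => t _; rewrite W_scaleE.
Qed.

Lemma zcoord_piv f u i : zcoord f u (piv i) = 0.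
Proof.
rewrite /zcoord /nfc; under eq_bigr do rewrite rho_piv eq_sym.
by rewrite (sum_mul_delta (fun i => f (firstarr len_gt0 u) (pb (piv i)))) subrr.
Qed.

Lemma yelE i g : yel k len i g = (g == firstarr len_gt0 i)%:R *: pv (pa g).
Proof. by rewrite /yel ffunE first_arr; case: eqP; rewrite ?scale1r ?scale0r. Qed.

Lemma bar0E p (h : kQ) g : bar0 p h g = if g == firstarr len_gt0 p then h else 0.
Proof. by rewrite /bar0 ffunE first_arr. Qed.

Lemma telE (C : {set 'I_n.+1}) : tel k len C = \sum_(i in C) 1 *: yel k len i.
Proof. by apply: eq_bigr => i _; rewrite scale1r. Qed.

Lemma branch_eig_yel i b : branch_eig (yel k len i) b = (b == i)%:R.
Proof.
rewrite /branch_eig; under eq_bigr => g _ do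
  rewrite yelE kQ_scaleE pvE eqxx mulr1 eq_sym -[X in X%:R]mul1n natrM.
rewrite (sum_mul_delta_cond (fun g => abr g == b) (fun=> 1%:R)) abr_firstarr eq_sym.
by case: eqP.
Qed.

Lemma branch_eig_tel C b : branch_eig (tel k len C) b = (b \in C)%:R.
Proof.
rewrite telE branch_eig_sum; under eq_bigr do rewrite branch_eig_yel.
by rewrite sum_mul_delta_cond; case: ifP.
Qed.

Lemma branch_eig_bar0 p h b : inZ p -> (1 < len b)%N -> branch_eig (bar0 p h : W) b = 0.
Proof.
move=> /eqP lp lb; rewrite /branch_eig big1 // => g /eqP gb; rewrite bar0E.
case: eqP => [eg|_]; last by rewrite ffunE.
by move: lb; rewrite -gb eg abr_firstarr lp.
Qed.

Lemma zcoord_yel i u s : inZ u -> (1 < len i)%N -> zcoord (yel k len i) u s = 0.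
Proof.
move=> /eqP lu li; rewrite /zcoord yelE nfcZ.
case: eqP => [/(congr1 (@abr n len))|_]; last by rewrite mul0r.
by rewrite !abr_firstarr => e; rewrite -e lu in li.
Qed.

Lemma zcoord_tel (C : {set 'I_n.+1}) u s : inZ u -> (forall i, i \in C -> (1 < len i)%N) ->
  zcoord (tel k len C) u s = 0.
Proof.
move=> uZ hC; rewrite telE zcoord_sum big1 // => i iC.
by rewrite zcoord_yel ?mulr0 // hC.
Qed.

Lemma firstarr_eq u p : (firstarr len_gt0 u == firstarr len_gt0 p) = (u == p).
Proof.
apply/eqP/eqP => [/(congr1 (@abr n len))|->//].
by rewrite !abr_firstarr.
Qed.

(** Since [q] is not a pivot, reduction by the [rhov i] leaves [brv q] unchanged, and the result is
    an elementary matrix. *)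
Lemma zcoord_bar0 p q u s : (forall i, piv i != q) ->
  zcoord (bar0 p (brv q)) u s = ((u, s) == (p, q))%:R.
Proof.
move=> hq; rewrite /zcoord bar0E firstarr_eq xpair_eqE.
case: eqP => _; first by rewrite nfc_brv.
have := nfcB 0 0 s; rewrite subrr => ->; exact: subrr.
Qed.

Lemma homE_sum (T : finType) (P : pred T) (c : T -> k) (F : T -> W) :
  (forall t, P t -> homE (F t)) -> homE (\sum_(t | P t) c t *: F t).
Proof.
move=> hF g q; rewrite W_sumE kQ_sumE => ne.
have [t Pt] : exists2 t, P t & F t g q != 0.
  apply/exists_inP; apply: contraNT ne => /exists_inPn h.
  rewrite big1 // => t /h; rewrite negbK W_scaleE kQ_scaleE => /eqP ->.
  by rewrite mulr0.
exact: hF.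
Qed.

Lemma homE_yel i : homE (yel k len i).
Proof.
have -> : yel k len i = [ffun g => (g == firstarr len_gt0 i)%:R *: pv (pa g)].
  by apply/ffunP => g; rewrite yelE ffunE.
exact: homE_scale_pa.
Qed.

Lemma homE_tel C : homE (tel k len C).
Proof. by rewrite telE; apply: homE_sum => i _; apply: homE_yel. Qed.

Lemma piv_len i : (1 < len (piv i))%N.
Proof. by apply: (@rho_len i); rewrite rho_piv eqxx oner_neq0. Qed.

Lemma homE_bar0 p q : inZ p -> homE (bar0 p (brv q)).
Proof.
move=> /eqP lp g x; rewrite bar0E; case: (g =P _) => [->|_]; last by rewrite ffunE eqxx.
rewrite (brvE k len_gt0) pvE; case: (x =P _) => [-> _|]; last by rewrite eqxx.
rewrite -[qsrc _]/(psrc (brpath len_gt0 q)) -[qtgt _]/(ptgt (brpath len_gt0 q)).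
rewrite psrc_brpath ptgt_brpath eq_sym asrc_eq0 // aidx_firstarr eqxx /= eq_sym atgt_eqomega //.
by rewrite abr_firstarr lp.
Qed.

Lemma inKer_bar0 p q : inZ p -> inKer mono rho (bar0 p (brv q)).
Proof.
move=> pZ; apply/inKerP; first exact: homE_bar0.
by move=> i b rb; rewrite !branch_eig_bar0 // ?piv_len // (rho_len rb).
Qed.

Lemma inKer_yel i : hasMono i -> inKer mono rho (yel k len i).
Proof.
move=> mi; apply/inKerP; first exact: homE_yel.
move=> j b rb; rewrite !branch_eig_yel.
have [e|_] := eqVneq b i; first by have := rho_hasMono rb; rewrite e mi.
by have [e|//] := eqVneq (piv j) i; have := piv_hasMono j; rewrite e mi.
Qed.

Lemma inKer_xel j : inZ j -> inZ ord0 -> inKer mono rho (xel k len j).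
Proof.
move=> jZ oZ; apply/inKerP; first by apply: homE_sub; apply: homE_bar0.
move=> i b rb; by rewrite !branch_eigB !branch_eig_bar0 // ?piv_len // (rho_len rb).
Qed.

(** * Connected components of [Q_rho] *)

Lemma inVrho_rho i b : rho i b != 0 -> inVrho b.
Proof. by move=> rb; rewrite /inVrho (rho_len rb) (rho_hasMono rb). Qed.

Lemma erho_sym : symmetric erho.
Proof.
move=> b b'; rewrite /erho andbCA; do 2!congr (_ && _).
by apply: eq_existsb => i; rewrite andbC.
Qed.

Lemma erho_csym : connect_sym erho.
Proof. exact: sym_connect_sym erho_sym. Qed.

Lemma erho_piv i b : rho i b != 0 -> erho b (piv i).
Proof.
move=> rb; have rp : rho i (piv i) != 0 by rewrite rho_piv eqxx oner_neq0.
rewrite /erho (inVrho_rho rb) (inVrho_rho rp); apply/existsP; exists i.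
by rewrite rb rp.
Qed.

Definition component b : {set 'I_n.+1} := [set b' | connect erho b b'].

Lemma mem_component b : b \in component b.
Proof. by rewrite inE connect0. Qed.

Lemma component_connect b b' : connect erho b b' -> component b = component b'.
Proof. by move=> h; apply/setP => x; rewrite !inE (same_connect erho_csym h). Qed.

Lemma component_in_comps b : inVrho b -> component b \in comps.
Proof.
move=> vb; rewrite mem_undup; apply: (map_f component).
by rewrite mem_filter vb mem_enum.
Qed.

(** [erho] is a relation on all branches, but its edges stay inside [inVrho]; hence the component of
    a vertex of [Q_rho] contains only such vertices. *)
Lemma mem_comps C b : C \in comps -> (b \in C) = inVrho b && (C == component b).
Proof.
rewrite mem_undup => /mapP[b0]; rewrite mem_filter => /andP[vb0 _] ->.
rewrite inE -/(component b0); apply/idP/andP => [h|[_ /eqP e]]; last first.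
  by have := mem_component b; rewrite -e inE.
split; last by rewrite (component_connect h).
have cl : closed erho [pred x | inVrho x] by move=> x y /and3P[vx vy _]; rewrite !inE vx vy.
by have := closed_connect cl h; rewrite !inE vb0 => <-.
Qed.

Lemma comps_len C i : C \in comps -> i \in C -> (1 < len i)%N.
Proof. by move=> hC; rewrite (mem_comps _ hC) => /andP[/andP[]]. Qed.

(** The support of each [rho i] lies in the component of its pivot, so the indicator of a component
    is constant on it. *)
Lemma inKer_tel C : C \in comps -> inKer mono rho (tel k len C).
Proof.
move=> hC; apply/inKerP; first exact: homE_tel.
move=> i b rb; rewrite !branch_eig_tel !mem_comps //.
have rp : rho i (piv i) != 0 by rewrite rho_piv eqxx oner_neq0.
by rewrite (component_connect (connect1 (erho_piv rb))) (inVrho_rho rb) (inVrho_rho rp).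
Qed.

Lemma inKer_connect f b b' : inKer mono rho f -> connect erho b b' ->
  branch_eig f b = branch_eig f b'.
Proof.
move=> kf; have /(inKerP (proj1 kf)) h := kf.
have cl : closed erho [pred x | branch_eig f b == branch_eig f x].
  move=> x y /and3P[_ _ /existsP[i /andP[rx ry]]].
  by rewrite !inE (h i x) // (h i y).
by move/(closed_connect cl); rewrite !inE eqxx => /esym/eqP.
Qed.

Lemma sum_comps (P : pred {set 'I_n.+1}) (c : {set 'I_n.+1} -> k) b :
  \sum_(C | (C \in comps) && P C) c C * branch_eig (tel k len C) b
  = if inVrho b && P (component b) then c (component b) else 0.
Proof.
case: (boolP (inVrho b)) => /= vb; last first.
  apply: big1 => C /andP[hC _].
  by rewrite branch_eig_tel mem_comps // (negPf vb) mulr0.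
under eq_bigr => C /andP[hC _] do rewrite branch_eig_tel mem_comps // vb eq_sym.
by rewrite sum_mul_delta_cond component_in_comps.
Qed.

(** Pivot columns may be left out: their coordinates vanish, and so do the corresponding entries of
    the identity, since no pivot lies in [Z]. *)
Lemma inImg_coordP (f : W) : homE f ->
  (exists lam : k, (forall b, (1 < len b)%N -> branch_eig f b = lam) /\
     (forall u s, inZ u -> ~~ hasMono s -> (forall i, piv i != s) ->
        zcoord f u s = lam * (u == s)%:R))
  <-> inImg mono rho f.
Proof.
move=> hf; split=> [[lam [hb hz]]|/(inImgP hf)[lam [hb hz]]]; last first.
  by exists lam; split=> // u s uZ ms _; rewrite eq_sym; apply: hz.
apply/(inImgP hf); exists lam; split=> // u s uZ ms; rewrite -/(zcoord f u s).
case: (boolP [exists i, piv i == s]) => [/existsP[i /eqP <-]|/existsPn ps].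
  by rewrite zcoord_piv (negPf (inZ_piv uZ i)) mulr0.
by rewrite hz // eq_sym.
Qed.

Lemma homE_family (J : finType) (F : J -> W) (P : pred J) (c : J -> k) :
  (forall j, P j -> inKer mono rho (F j)) -> homE (\sum_(j | P j) c j *: F j).
Proof. by move=> h; apply: homE_sum => j /h[]. Qed.

Lemma mem_sum_seq (A B : eqType) (s : seq A) (t : seq B) (j : A + B) :
  (j \in map inl s ++ map inr t) = match j with inl x => x \in s | inr y => y \in t end.
Proof.
rewrite mem_cat; case: j => [x|y].
  rewrite mem_map; last by move=> ? ? [].
  by case: mapP => [[]|_]; rewrite ?orbF.
rewrite orbC mem_map; last by move=> ? ? [].
by case: mapP => [[]|_]; rewrite ?orbF.
Qed.

Lemma uniq_sum_seq (A B : eqType) (s : seq A) (t : seq B) :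
  uniq s -> uniq t -> uniq (map inl s ++ map inr t : seq (A + B)).
Proof.
move=> us ut; rewrite cat_uniq !map_inj_uniq ?us ?ut => [|? ? []|? ? []] //.
by rewrite andbT; apply/hasPn => j /mapP[y _ ->]; apply/mapP => -[].
Qed.

(** Value 0 of [bclass] means exactly [Z], so the monotone numbering puts these arrows first. This
    matters because [xel] takes [ord0] as its reference branch. *)
Lemma inZ_ord0 : (0 < aZ len)%N -> inZ ord0.
Proof.
case/card_gt0P => b; rewrite inE => bZ.
case: num => _ /(_ ord0 b (leq0n b)); rewrite /bclass bZ.
by case: ifP => //; do 2!case: ifP => //.
Qed.

(** An arbitrary member, whose choice does not matter for cocycles. The default [ord0] occurs only
    for the empty set. *)
Definition rep (C : {set 'I_n.+1}) : 'I_n.+1 := odflt ord0 [pick b in C].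

Lemma branch_eig_rep f b : inKer mono rho f -> branch_eig f (rep (component b)) = branch_eig f b.
Proof.
move=> kf; rewrite /rep; case: pickP => [b'|/(_ b)]; last by rewrite mem_component.
by rewrite inE => h; rewrite (inKer_connect kf h).
Qed.

Lemma comps_component C : C \in comps -> exists2 b, inVrho b & C = component b.
Proof.
by rewrite mem_undup => /mapP[b]; rewrite mem_filter => /andP[vb _] ->; exists b.
Qed.

Lemma inZ_hasMono b : inZ b -> ~~ hasMono b.
Proof. by move=> /eqP lb; apply/negP => /hasMono_len; rewrite lb. Qed.

(** * The case [a > 0] *)

Definition idxA : finType := ('I_n.+1 + (('I_n.+1 * 'I_n.+1) +
  (('I_n.+1 * 'I_n.+1) + ('I_n.+1 + {set 'I_n.+1}))))%type.

Definition elA (j : idxA) : W :=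
  match j with
  | inl i => yel k len i
  | inr (inl pq) => wel k len pq.1 pq.2
  | inr (inr (inl us)) => zel k len us.1 us.2
  | inr (inr (inr (inl j))) => xel k len j
  | inr (inr (inr (inr C))) => tel k len C
  end.

Definition memA : pred idxA := fun j =>
  match j with
  | inl i => hasMono i
  | inr (inl pq) => [&& inZ pq.1, inZ pq.2 & pq.1 != pq.2]
  | inr (inr (inl us)) => inZ us.1 && Bset mono piv us.2
  | inr (inr (inr (inl j))) => inZ j && (j != ord0)
  | inr (inr (inr (inr C))) => C \in comps
  end.

(** Listed in the order of [famA]. The tags of the sum type keep indices of different kinds apart,
    so uniqueness is checked without comparing cochains. *)
Definition seqA : seq idxA :=
  let pairs := [seq (p, q) | p <- enum 'I_n.+1, q <- enum 'I_n.+1] in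
  map inl [seq i <- enum 'I_n.+1 | hasMono i] ++
  map inr (map inl [seq pq <- pairs | [&& inZ pq.1, inZ pq.2 & pq.1 != pq.2]] ++
  map inr (map inl [seq us <- pairs | inZ us.1 && Bset mono piv us.2] ++
  map inr (map inl [seq j <- enum 'I_n.+1 | inZ j && (j != ord0)] ++
  map inr comps))).

Lemma famA_seqA : famA mono rho piv = [seq elA j | j <- seqA].
Proof. by rewrite /seqA /famA !(map_cat, =^~ map_comp). Qed.

Lemma mem_pairs (p : 'I_n.+1 * 'I_n.+1) :
  p \in [seq (p, q) | p <- enum 'I_n.+1, q <- enum 'I_n.+1].
Proof. by case: p => p q; apply/allpairsP; exists (p, q); rewrite !mem_enum. Qed.

Lemma mem_seqA j : (j \in seqA) = memA j.
Proof.
rewrite mem_sum_seq; case: j => [i|j]; first by rewrite mem_filter mem_enum andbT.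
rewrite mem_sum_seq; case: j => [p|j]; first by rewrite mem_filter mem_pairs andbT.
rewrite mem_sum_seq; case: j => [p|j]; first by rewrite mem_filter mem_pairs andbT.
rewrite mem_sum_seq; case: j => [i|C //]; by rewrite mem_filter mem_enum andbT.
Qed.

Lemma uniq_seqA : uniq seqA.
Proof.
have up : uniq [seq (p, q) | p <- enum 'I_n.+1, q <- enum 'I_n.+1].
  by apply: allpairs_uniq; rewrite ?enum_uniq // => -[? ?] [? ?] _ _ /= [-> ->].
have ue (P : pred 'I_n.+1) : uniq [seq i <- enum 'I_n.+1 | P i].
  exact/filter_uniq/enum_uniq.
by do ![apply: uniq_sum_seq]; rewrite ?ue ?(filter_uniq _ up) ?undup_uniq.
Qed.

Lemma inKer_elA j : inZ ord0 -> memA j -> inKer mono rho (elA j).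
Proof.
move=> oZ; case: j => [i|[pq|[us|[j|C]]]] /=.
- exact: inKer_yel.
- by case/and3P => pZ _ _; apply: inKer_bar0.
- by case/andP => uZ _; apply: inKer_bar0.
- by case/andP => jZ _; apply: inKer_xel.
- exact: inKer_tel.
Qed.

Lemma Bset_piv s : Bset mono piv s -> forall i, piv i != s.
Proof. by move=> /andP[_ /existsPn]. Qed.

(** Elements supported on [Z] contribute nothing to a longer branch. A branch with a monomial
    relation meets only its own [yel], any other one only the [tel] of its component. *)
Lemma branch_eig_famA (c : idxA -> k) b : inZ ord0 -> (1 < len b)%N ->
  branch_eig (\sum_(j | memA j) c j *: elA j) b
  = if hasMono b then c (inl b) else c (inr (inr (inr (inr (component b))))).
Proof.
move=> oZ lb; rewrite branch_eig_sum !big_sumType /=.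
under eq_bigr do rewrite branch_eig_yel.
rewrite sum_mul_delta_cond.
rewrite big1 => [|pq /and3P[pZ _ _]]; last by rewrite branch_eig_bar0 // mulr0.
rewrite big1 => [|us /andP[uZ _]]; last by rewrite branch_eig_bar0 // mulr0.
rewrite big1 => [|j /andP[jZ _]]; last by rewrite branch_eigB !branch_eig_bar0 // subrr mulr0.
rewrite (eq_bigl (fun C => (C \in comps) && xpredT C)) => [|C]; last by rewrite andbT.
rewrite (sum_comps xpredT (fun C => c (inr (inr (inr (inr C)))))) !add0r andbT /inVrho lb /=.
by case: ifP; rewrite ?addr0 ?add0r.
Qed.

(** Each entry receives one coefficient, except the one at ([ord0], [ord0]), to which every [xel]
    contributes with a minus sign. Thus the square block on [Z] has trace 0 and is otherwise
    arbitrary. *)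
Lemma zcoord_famA (c : idxA -> k) u s : inZ ord0 -> inZ u -> ~~ hasMono s ->
  (forall i, piv i != s) ->
  zcoord (\sum_(j | memA j) c j *: elA j) u s
  = if inZ s then
      if u != s then c (inr (inl (u, s))) else
      if u != ord0 then c (inr (inr (inr (inl u))))
      else - \sum_(j | inZ j && (j != ord0)) c (inr (inr (inr (inl j))))
    else c (inr (inr (inl (u, s)))).
Proof.
move=> oZ uZ ms ps; rewrite zcoord_sum !big_sumType /=.
rewrite big1 => [|i mi]; last by rewrite zcoord_yel ?mulr0 // hasMono_len.
under eq_bigr => pq /and3P[_ qZ _] do rewrite (zcoord_bar0 _ _ _ (inZ_piv qZ)).
rewrite (sum_mul_delta_cond (fun pq => [&& inZ pq.1, inZ pq.2 & pq.1 != pq.2])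
  (fun pq => c (inr (inl pq)))).
under eq_bigr => us /andP[_ /Bset_piv hs] do rewrite (zcoord_bar0 _ _ _ hs).
rewrite (sum_mul_delta_cond (fun us => inZ us.1 && Bset mono piv us.2)
  (fun us => c (inr (inr (inl us))))).
rewrite [X in _ + (_ + (_ + (_ + X)))]big1 ?addr0 => [|C hC]; last first.
  by rewrite zcoord_tel ?mulr0 // => i; apply: comps_len.
(* [xel j] is the elementary matrix at ([j], [j]) minus the one at ([ord0], [ord0]). *)
have -> : \sum_(j | inZ j && (j != ord0)) c (inr (inr (inr (inl j)))) * zcoord (xel k len j) u s
   = \sum_(j | inZ j && (j != ord0)) c (inr (inr (inr (inl j)))) * (u == j)%:R * (u == s)%:R
     - \sum_(j | inZ j && (j != ord0)) c (inr (inr (inr (inl j)))) * ((u == ord0) && (u == s))%:R.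
  rewrite -sumrB; apply: eq_bigr => j /andP[jZ _].
  rewrite zcoordB (zcoord_bar0 _ _ _ (inZ_piv jZ)) (zcoord_bar0 _ _ _ (inZ_piv oZ)).
  rewrite mulrBr -mulrA -natrM mulnb !xpair_eqE; congr (_ * _%:R - _ * _%:R).
    by case: (u =P j) => [->|//]; rewrite eq_sym.
  by case: (u =P ord0) => [->|//]; rewrite eq_sym.
rewrite -!mulr_suml (sum_mul_delta_cond (fun j => inZ j && (j != ord0))) /= uZ.
rewrite /Bset ms /=.
have -> : isPivot piv s = false by apply/existsP => -[i]; rewrite (negPf (ps i)).
rewrite add0r andbT; have [sZ|nZ] := boolP (inZ s).
  have [->|nus] := eqVneq u s;
    rewrite /= ?mulr0 ?subr0 ?addr0 ?mulr1 ?andbT ?andbF ?mulr0 ?subr0 ?addr0 // add0r add0r.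
  by have [_|_] := eqVneq s ord0; rewrite ?mulr1 ?mulr0 ?subr0 ?sub0r.
have -> : (u == s) = false by apply: contraNF nZ => /eqP <-.
by rewrite /= andbF !mulr0 subr0 addr0 add0r.
Qed.

Lemma famA_basis : [pchar k] =i pred0 -> (0 < aZ len)%N ->
  quot_basis (inKer mono rho) (inImg mono rho) (famA mono rho piv).
Proof.
move=> char0 a_gt0; have oZ := inZ_ord0 a_gt0.
(* In characteristic zero the identity on [Z] has nonzero trace. *)
have a_neq0 : (aZ len)%:R != 0 :> k.
  by rewrite (pcharf0P k).1 // -lt0n.
have sumZ (x : k) : x + \sum_(j | inZ j && (j != ord0)) x = x * (aZ len)%:R.
  by rewrite mulr_natr /aZ cardsE -sumr_const [RHS](bigD1 ord0).
have kE (c : idxA -> k) : \sum_(j in seqA) c j *: elA j = \sum_(j | memA j) c j *: elA j.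
  by apply: eq_bigl => j; rewrite mem_seqA.
rewrite famA_seqA; apply: quot_basis_map.
- exact: uniq_seqA.
- by move=> j; rewrite mem_seqA; apply: inKer_elA.
- move=> f kf; have [hf _] := kf.
  (* The mean of the diagonal makes f - lam * id of trace 0 on Z. *)
  pose lam := (\sum_(u | inZ u) zcoord f u u) / (aZ len)%:R.
  exists (fun j => match j with
    | inl i => branch_eig f i - lam
    | inr (inl pq) => zcoord f pq.1 pq.2
    | inr (inr (inl us)) => zcoord f us.1 us.2
    | inr (inr (inr (inl j))) => zcoord f j j - lam
    | inr (inr (inr (inr C))) => branch_eig f (rep C) - lam
    end).
  rewrite kE; apply/inImg_coordP.
    apply: homE_sub => //; apply: homE_family => j; exact: inKer_elA.
  exists lam; split=> [b lb|u s uZ ms ps].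
    rewrite branch_eigB branch_eig_famA // branch_eig_rep //.
    by case: ifP => _; rewrite opprB addrC subrK.
  rewrite zcoordB zcoord_famA //=.
  have [sZ|nZ] := boolP (inZ s); last first.
    rewrite subrr; have [e|_] := eqVneq u s; last by rewrite mulr0.
    by rewrite -e uZ in nZ.
  have [<-{s sZ ms ps}|nus] := eqVneq u s; last by rewrite subrr mulr0.
  rewrite mulr1; have [->{u uZ}|nu0] := eqVneq u ord0; last by rewrite opprB addrC subrK.
  (* At ([ord0], [ord0]) the claim becomes that the trace of [f] on [Z] is [a] times [lam]. *)
  rewrite opprK sumrB addrA; apply/eqP; rewrite subr_eq sumZ /lam divfK //.
  by rewrite [X in _ == X](bigD1 ord0).
- move=> c; rewrite kE => hI.
  have hc : homE (\sum_(j | memA j) c j *: elA j).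
    by apply: homE_family => j; apply: inKer_elA.
  have /(inImg_coordP hc)[lam [hb hz]] := hI.
  have {}hz u s (uZ : inZ u) (ms : ~~ hasMono s) (ps : forall i, piv i != s) :=
    etrans (esym (zcoord_famA c oZ uZ ms ps)) (hz u s uZ ms ps).
  have cX j : inZ j -> j != ord0 -> c (inr (inr (inr (inl j)))) = lam.
    move=> jZ nj0; have := hz j j jZ (inZ_hasMono jZ) (inZ_piv jZ).
    by rewrite jZ eqxx nj0 mulr1.
  (* All diagonal entries equal [lam] while the trace is 0, so [a] times [lam] vanishes. *)
  have lam0 : lam = 0.
    have := hz ord0 ord0 oZ (inZ_hasMono oZ) (inZ_piv oZ).
    rewrite oZ !eqxx mulr1 (eq_bigr (fun=> lam)) => [/= e|j /andP[]]; last exact: cX.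
    apply/eqP; have := sumZ lam; rewrite -{1}e addNr => /esym/eqP.
    by rewrite mulf_eq0 (negPf a_neq0) orbF.
  rewrite lam0 in hb hz cX => j; rewrite mem_seqA.
  case: j => [i|[[p q]|[[u s]|[j|C]]]] /=.
  + by move=> mi; have := hb i (hasMono_len mi); rewrite branch_eig_famA ?hasMono_len // mi.
  + case/and3P => pZ qZ npq; have := hz p q pZ (inZ_hasMono qZ) (inZ_piv qZ).
    by rewrite qZ npq mul0r.
  + case/andP => uZ sB; have /andP[/andP[nsZ ms] _] := sB.
    by have := hz u s uZ ms (Bset_piv sB); rewrite (negPf nsZ) mul0r.
  + by case/andP; apply: cX.
  + move=> hC; have [b /andP[lb mb] ->] := comps_component hC.
    by have := hb b lb; rewrite branch_eig_famA // (negPf mb).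
Qed.

(** * The case [a = 0] *)

Definition el0 (j : 'I_n.+1 + {set 'I_n.+1}) : W :=
  match j with inl i => yel k len i | inr C => tel k len C end.

Definition mem0 : pred ('I_n.+1 + {set 'I_n.+1}) := fun j =>
  match j with
  | inl i => hasMono i && (i != ord_max)
  | inr C => (C \in comps) && (ord_max \notin C)
  end.

Definition seq0 : seq ('I_n.+1 + {set 'I_n.+1}) :=
  map inl [seq i <- enum 'I_n.+1 | hasMono i && (i != ord_max)] ++
  map inr [seq C : {set 'I_n.+1} <- comps | ord_max \notin C].

Lemma fam0_seq0 : fam0 mono rho = [seq el0 j | j <- seq0].
Proof. by rewrite /seq0 /fam0 map_cat -!map_comp. Qed.

Lemma mem_seq0 j : (j \in seq0) = mem0 j.
Proof.
by rewrite mem_sum_seq; case: j => [i|C]; rewrite mem_filter ?mem_enum ?andbT // andbC.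
Qed.

Lemma uniq_seq0 : uniq seq0.
Proof.
by apply: uniq_sum_seq; apply: filter_uniq; rewrite ?undup_uniq ?enum_uniq.
Qed.

(** The omitted element is the only [yel] or [tel] with a nonzero scalar on the last branch, so
    every combination of the others vanishes there. *)
Lemma branch_eig_fam0 (c : 'I_n.+1 + {set 'I_n.+1} -> k) b : (1 < len b)%N ->
  branch_eig (\sum_(j | mem0 j) c j *: el0 j) b
  = if hasMono b then if b != ord_max then c (inl b) else 0
    else if ord_max \notin component b then c (inr (component b)) else 0.
Proof.
move=> lb; rewrite branch_eig_sum !big_sumType /=.
under eq_bigr do rewrite branch_eig_yel.
rewrite sum_mul_delta_cond (sum_comps (fun C => ord_max \notin C) (fun C => c (inr C))).
by rewrite /inVrho lb /=; case: (hasMono b); rewrite ?addr0 ?add0r.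
Qed.

Lemma fam0_basis : aZ len = 0%N ->
  quot_basis (inKer mono rho) (inImg mono rho) (fam0 mono rho).
Proof.
move=> a0.
have noZ b : inZ b = false.
  by move/cards0_eq/setP: a0 => /(_ b); rewrite !inE.
have len_gt1 b : (1 < len b)%N.
  by have := noZ b; rewrite /inZ ltn_neqAle eq_sym => ->; rewrite len_gt0.
have kE (c : 'I_n.+1 + {set 'I_n.+1} -> k) :
    \sum_(j in seq0) c j *: el0 j = \sum_(j | mem0 j) c j *: el0 j.
  by apply: eq_bigl => j; rewrite mem_seq0.
have inKer_el0 j : mem0 j -> inKer mono rho (el0 j).
  by case: j => [i|C] /andP[h _]; [apply: inKer_yel | apply: inKer_tel].
rewrite fam0_seq0; apply: quot_basis_map.
- exact: uniq_seq0.
- by move=> j; rewrite mem_seq0; apply: inKer_el0.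
- move=> f kf; have [hf _] := kf.
  (* The family acts by 0 on the last branch, so the scalar of [f] there must be [lam]. *)
  pose lam := branch_eig f ord_max.
  exists (fun j => match j with
    | inl i => branch_eig f i - lam
    | inr C => branch_eig f (rep C) - lam
    end).
  rewrite kE; apply/inImg_coordP.
    by apply: homE_sub => //; apply: homE_family.
  exists lam; split=> [b _|u s]; last by rewrite noZ.
  rewrite branch_eigB branch_eig_fam0 // branch_eig_rep //.
  case: (hasMono b).
    by have [->|_] /= := eqVneq b ord_max; rewrite ?subr0 // opprB addrC subrK.
  case: ifPn => [_|]; first by rewrite opprB addrC subrK.
  (* On the component of the last branch, the cocycle condition forces the value [lam]. *)
  by rewrite negbK inE subr0 => /(inKer_connect kf).
- move=> c; rewrite kE => hI.
  have hc : homE (\sum_(j | mem0 j) c j *: el0 j) by apply: homE_family.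
  have /(inImg_coordP hc)[lam [hb _]] := hI.
  have {}hb b := etrans (esym (branch_eig_fam0 c (len_gt1 b))) (hb b (len_gt1 b)).
  have lam0 : lam = 0.
    by rewrite -(hb ord_max) eqxx mem_component; case: ifP.
  move=> j; rewrite mem_seq0; case: j => [i|C] /= /andP[].
    by move=> mi ni; have := hb i; rewrite mi ni lam0.
  move=> hC; have [b /andP[_ mb] ->] := comps_component hC => nC.
  by have := hb b; rewrite (negPf mb) nC lam0.
Qed.

End ToupieAlgebra.

Theorem theorem3p5 (k : fieldType) (n : nat) (len : 'I_n.+1 -> nat)
  (nm nn : nat) (mono : 'I_nm -> Path len) (rho : 'I_nn -> {ffun 'I_n.+1 -> k})
  (piv : 'I_nn -> 'I_n.+1) :
  [pchar k] =i pred0 ->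
  (forall b, 0 < len b)%N ->
  admissible (Iid mono rho) ->
  minimal_gen mono rho ->
  rref rho piv ->
  nonmono rho ->
  numbering mono rho ->
  ((0 < aZ len)%N ->
     quot_basis (inKer mono rho) (inImg mono rho) (famA mono rho piv)) /\
  (aZ len = 0%N ->
     quot_basis (inKer mono rho) (inImg mono rho) (fam0 mono rho)).
Proof.
move=> char0 len_gt0 adm _ rref_rho _ num.
split; first exact: (famA_basis len_gt0 adm rref_rho num char0).
exact: (fam0_basis len_gt0 adm rref_rho num).
Qed.
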